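(* Let $\mu\colon(X,\omega)\to B$ be a locally toric Lagrangian fibration on an $n$-dimensional base $B$ and let $\{(U_\alpha,\varphi^B_\alpha,\varphi^X_\alpha)\}$ be a system of local identifications of $\mu$ with $\mu_{\mathbb C^n}$. Then on each nonempty overlap $U_{\alpha\beta}:=U_\alpha\cap U_\beta$ there exists an element $\rho_{\alpha\beta}\in\mathrm{Aut}(T^n)$ such that $\varphi^X_\alpha\circ(\varphi^X_\beta)^{-1}\colon\mu_{\mathbb C^n}^{-1}(\varphi^B_\beta(U_{\alpha\beta}))\to\mu_{\mathbb C^n}^{-1}(\varphi^B_\alpha(U_{\alpha\beta}))$ is $\rho_{\alpha\beta}$-equivariant with respect to the standard representation of $T^n$.
   Context: $T^n=(S^1)^n$ acts on $\mathbb C^n$ by the standard representation $u\cdot z=(u_1z_1,\dots,u_nz_n)$; $\mathrm{Aut}(T^n)$ is the group of automorphisms of $T^n$, and $f$ is $\rho$-equivariant if $f(u\cdot x)=\rho(u)\cdot f(x)$. $\omega_{\mathbb C^n}=\frac{1}{2\pi\sqrt{-1}}\sum_{k=1}^n dz_k\wedge d\overline z_k$, $\mu_{\mathbb C^n}(z)=(|z_1|^2,\dots,|z_n|^2)$, with image $\mathbb R^n_{\ge0}=\{\xi\in\mathbb R^n:\xi_i\ge0\}$. Let $(X,\omega)$ be a $2n$-dimensional closed $C^\infty$ symplectic manifold and $B$ an $n$-dimensional $C^\infty$ manifold with corners. A $C^\infty$ map $\mu\colon(X,\omega)\to B$ is a locally toric Lagrangian fibration if there is a system $\{(U_\alpha,\varphi^B_\alpha)\}$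 of coordinate neighborhoods of $B$ modeled on $\mathbb R^n_{\ge0}$ and, for each $\alpha$, a symplectomorphism $\varphi^X_\alpha\colon(\mu^{-1}(U_\alpha),\omega)\to(\mu_{\mathbb C^n}^{-1}(\varphi^B_\alpha(U_\alpha)),\omega_{\mathbb C^n})$ with $\mu_{\mathbb C^n}\circ\varphi^X_\alpha=\varphi^B_\alpha\circ\mu$; such a collection $\{(U_\alpha,\varphi^B_\alpha,\varphi^X_\alpha)\}$ is a system of local identifications. By convention every overlap of two open sets is connected. *)

(* Defs.v *)
From HB Require Import structures.
From mathcomp Require Import all_boot all_order all_algebra.
From mathcomp Require Import complex.
From mathcomp Require Import all_classical all_reals all_analysis.

Set Implicit Arguments.
Unset Strict Implicit.
Unset Printing Implicit Defensive.

Import Order.TTheory GRing.Theory Num.Theory.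
Import numFieldNormedType.Exports.

Local Open Scope classical_set_scope.
Local Open Scope ring_scope.

Section Smooth.
Context {R : realType}.

Definition iter_derive {V W : normedModType R} (f : V -> W) (vs : seq V) :
    V -> W :=
  foldr (fun v g x => 'D_v g x) f vs.

(* C^oo on an open set: all iterated directional derivatives exist and are
   (Frechet) differentiable, hence continuous, there. *)
Definition smooth_open {V W : normedModType R} (U : set V) (f : V -> W) : Prop :=
  forall (vs : seq V) (x : V), U x -> differentiable (iter_derive f vs) x.

(* On an arbitrary subset, a map is C^oo when it extends locally to a C^oo map
   on an open set; this is the notion used at boundary points and corners. *)
Definition smooth_on {V W : normedModType R} (D : set V) (f : V -> W) : Prop :=
  forall x, D x -> exists (U : set V) (g : V -> W),
    [/\ open U, U x, smooth_open U g & forall y, D y -> U y -> f y = g y].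

Definition orthant (n : nat) : set 'rV[R]_n := [set x | forall i, 0 <= x 0 i].

End Smooth.
Arguments orthant R n : clear implicits.

(* A chart modeled on [M]: [M = setT] gives manifolds without boundary,
   [M = orthant R m] gives manifolds with corners.
   [chart_inv] is only meaningful on the image of [chart_dom]. *)
Record chart (R : realType) (m : nat) (M : set 'rV[R]_m) (T : topologicalType) :=
  Chart {
    chart_dom : set T;
    chart_map :> T -> 'rV[R]_m;
    chart_inv : 'rV[R]_m -> T;
    chart_dom_open : open chart_dom;
    chart_cod_open :
      exists2 U : set 'rV[R]_m, open U & chart_map @` chart_dom = U `&` M;
    chart_mapK : forall x, chart_dom x -> chart_inv (chart_map x) = x;
    chart_map_cont : {within chart_dom, continuous chart_map};
    chart_inv_cont : {within chart_map @` chart_dom, continuous chart_inv}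
  }.

Definition chart_cod (R : realType) (m : nat) (M : set 'rV[R]_m)
    (T : topologicalType) (c : chart M T) : set 'rV[R]_m :=
  c @` chart_dom c.

Definition smooth_transition (R : realType) (m : nat) (M : set 'rV[R]_m)
    (T : topologicalType) (c d : chart M T) : Prop :=
  smooth_on (c @` (chart_dom c `&` chart_dom d)) (d \o chart_inv c).

Record manifold (R : realType) (m : nat) (M : set 'rV[R]_m) := Manifold {
  manifold_carrier :> topologicalType;
  atlas_index : Type;
  atlas : atlas_index -> chart M manifold_carrier;
  atlas_cover : \bigcup_i chart_dom (atlas i) = [set: manifold_carrier];
  atlas_smooth : forall i j, smooth_transition (atlas i) (atlas j);
  manifold_hausdorff : hausdorff_space manifold_carrier;
  manifold_second_countable : @second_countable manifold_carrier
}.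

(* [c] belongs to the maximal atlas. *)
Definition smooth_chart (R : realType) (m : nat) (M : set 'rV[R]_m)
    (X : manifold M) (c : chart M X) : Prop :=
  forall i : atlas_index X,
    smooth_transition c (atlas i) /\ smooth_transition (atlas i) c.

Section SmoothMaps.
Context {R : realType} {m k : nat} {M : set 'rV[R]_m} {N : set 'rV[R]_k}.
Variables (X : manifold M) (Y : manifold N).

Definition local_expr (f : X -> Y) (i : atlas_index X) (j : atlas_index Y) :
    'rV[R]_m -> 'rV[R]_k :=
  atlas j \o f \o chart_inv (atlas i).

Definition local_expr_dom (D : set X) (f : X -> Y)
    (i : atlas_index X) (j : atlas_index Y) : set 'rV[R]_m :=
  atlas i @` (D `&` chart_dom (atlas i) `&` f @^-1` chart_dom (atlas j)).

Definition smooth_map (D : set X) (f : X -> Y) : Prop :=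
  {within D, continuous f} /\
  forall i j, smooth_on (local_expr_dom D f i j) (local_expr f i j).

End SmoothMaps.

Definition diffeo (R : realType) (m k : nat) (M : set 'rV[R]_m)
    (N : set 'rV[R]_k) (X : manifold M) (Y : manifold N)
    (D : set X) (E : set Y) (f : X -> Y) (g : Y -> X) : Prop :=
  [/\ set_fun D E f, set_fun E D g,
      (forall x, D x -> g (f x) = x) /\ (forall y, E y -> f (g y) = y),
      smooth_map D f & smooth_map E g].

(* A 2-form, given in each chart by its coefficient matrices
   [omega i x a b = omega (d/dx_a) (d/dx_b)]. *)
Definition two_form (R : realType) (m : nat) (X : manifold [set: 'rV[R]_m]) :=
  atlas_index X -> 'rV[R]_m -> 'M[R]_m.

(* In the library, ['d f x v = v *m 'J f x] on row vectors, so that the form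
   [v, w |-> v *m A *m w^T] pulls back to ['J f x *m A *m ('J f x)^T]. *)
Definition pullback_eq (R : realType) (m k : nat)
    (X : manifold [set: 'rV[R]_m]) (Y : manifold [set: 'rV[R]_k])
    (omegaX : two_form X) (omegaY : two_form Y) (D : set X) (f : X -> Y) : Prop :=
  forall i j x, local_expr_dom D f i j x ->
    let F := local_expr f i j in
    omegaX i x = 'J F x *m omegaY j (F x) *m ('J F x)^T.

Record symplectic (R : realType) (m : nat) (X : manifold [set: 'rV[R]_m])
    (omega : two_form X) : Prop := Symplectic {
  symplectic_compat : pullback_eq omega omega [set: X] idfun;
  symplectic_smooth : forall i, smooth_on (chart_cod (atlas i)) (omega i);
  symplectic_skew : forall i x, chart_cod (atlas i) x ->
    (omega i x)^T = - omega i x;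
  symplectic_nondegenerate : forall i x, chart_cod (atlas i) x ->
    omega i x \in unitmx;
  symplectic_closed : forall i x, chart_cod (atlas i) x -> forall a b c,
    'D_(delta_mx 0 a) (fun y => omega i y b c) x +
    'D_(delta_mx 0 b) (fun y => omega i y c a) x +
    'D_(delta_mx 0 c) (fun y => omega i y a b) x = 0
}.

Definition symplectomorphism (R : realType) (m : nat)
    (X Y : manifold [set: 'rV[R]_m]) (omegaX : two_form X) (omegaY : two_form Y)
    (D : set X) (E : set Y) (f : X -> Y) (g : Y -> X) : Prop :=
  diffeo D E f g /\ pullback_eq omegaX omegaY D f.

Section Euclidean.
Context (R : realType) (m : nat).
Local Notation V := 'rV[R]_m.

Lemma smooth_open_id : smooth_open [set: V] (@idfun V).
Proof.
have cstD (c : V) (ws : seq V) :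
    exists c' : V, iter_derive (cst c : V -> V) ws = cst c'.
  elim: ws => [|w ws [c' IH]]; first by exists c.
  exists 0; apply/funext => x /=.
  by rewrite -/(iter_derive _ ws) IH derive_cst.
move=> vs x _; case/lastP: vs => [|ws v] /=.
  exact: ex_diff.
have -> : iter_derive (@idfun V) (rcons ws v) = iter_derive (cst v : V -> V) ws.
  rewrite /iter_derive foldr_rcons; congr foldr.
  by apply/funext => y; rewrite derive_id.
by have [c' ->] := cstD v ws; exact: differentiable_cst.
Qed.

Lemma second_countable_rV : @second_countable V.
Proof.
pose q (v : 'rV[rat]_m) : V := map_mx ratr v.
exists [set U : set V | exists p : 'rV[rat]_m * nat,
                         U = ball (q p.1) (p.2.+1%:R^-1 : R)].
  have -> : [set U : set V | exists p : 'rV[rat]_m * nat,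
                         U = ball (q p.1) (p.2.+1%:R^-1 : R)] =
            (fun p : 'rV[rat]_m * nat => ball (q p.1) (p.2.+1%:R^-1 : R)) @`
              [set: 'rV[rat]_m * nat].
    by apply/seteqP; split => U /= [p]; [exists p | move=> _ <-; exists p].
  apply: (@card_le_trans _ _ _ [set: 'rV[rat]_m * nat]); first exact: card_image_le.
  exact: countableP.
split=> [_ [p ->]|x A].
  exact: ball_open.
rewrite -nbhs_ballE => -[e /= e0 eA].
have [k _ ke] : \forall k \near \oo, k.+1%:R^-1 < e / 2.
  by apply: near_infty_natSinv_lt (PosNum _); rewrite divr_gt0.
pose r : R := k.+1%:R^-1.
have r0 : 0 < r by rewrite invr_gt0.
have /choice [p px] : forall i, exists y : rat, `|x 0 i - ratr y| < r.
  move=> i; have [|y] := @rat_in_itvoo R (x 0 i - r) (x 0 i + r).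
    by rewrite ltrBlDr -addrA ltrDl addr_gt0.
  by rewrite in_itv /= => yx; exists y; rewrite distrC ltr_distl.
have xp : ball (q (\row_i p i)) r x.
  by split=> // i j; rewrite (ord1 i) /ball /= distrC !mxE.
exists (ball (q (\row_i p i)) r); first by split=> //; exists (\row_i p i, k).
move=> y py; apply: eA; apply: (@ball_splitr _ _ (q (\row_i p i))).
  by apply: le_ball xp; exact/ltW/ke/leqnn.
by apply: le_ball py; exact/ltW/ke/leqnn.
Qed.

Lemma id_chart_cod_open :
  exists2 U : set V, open U & idfun @` [set: V] = U `&` [set: V].
Proof. by exists setT; [exact: openT | rewrite image_id setIT]. Qed.

Lemma within_continuous_id (D : set V) : {within D, continuous (@idfun V)}.
Proof. by apply: continuous_subspaceT => x; exact: cvg_id. Qed.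

Definition id_chart : chart [set: V] V :=
  @Chart R m setT V setT idfun idfun openT id_chart_cod_open
    (fun x _ => erefl) (@within_continuous_id _) (@within_continuous_id _).

Lemma id_chart_cover : \bigcup_(i in [set: unit]) chart_dom id_chart = [set: V].
Proof. by apply/seteqP; split => // x _; exists tt. Qed.

Lemma id_chart_smooth (i j : unit) : smooth_transition id_chart id_chart.
Proof.
move=> x _; exists setT, idfun; split => //; first exact: openT.
exact: smooth_open_id.
Qed.

Definition euclidean : manifold [set: V] :=
  @Manifold R m setT V unit (fun=> id_chart) id_chart_cover id_chart_smooth
    (@norm_hausdorff R V) second_countable_rV.

End Euclidean.

Section ComplexSpace.
Context {R : realType} {n : nat}.

(* C^n is R^(n+n), the k-th complex coordinate of [row_mx x y] being
   [x_k + sqrt(-1) y_k]. *)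
Definition Cn : manifold [set: 'rV[R]_(n + n)] := euclidean R (n + n).

Definition zcoord (z : 'rV[R]_(n + n)) (k : 'I_n) : R[i] :=
  (z 0 (lshift n k) +i* z 0 (rshift n k))%C.

Definition of_zcoord (c : 'I_n -> R[i]) : Cn :=
  row_mx (\row_k complex.Re (c k)) (\row_k complex.Im (c k)).

(* Both the group law of T^n and its standard representation on C^n. *)
Definition cmul (u z : Cn) : Cn := of_zcoord (fun k => zcoord u k * zcoord z k).

Definition torus : set Cn := [set u | forall k, `|zcoord u k| = 1].

(* Automorphisms of T^n as a Lie group; [rho] is only meaningful on [torus]. *)
Definition torus_aut (rho : Cn -> Cn) : Prop :=
  (forall u v, torus u -> torus v -> rho (cmul u v) = cmul (rho u) (rho v)) /\
  exists sigma : Cn -> Cn, diffeo torus torus rho sigma.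

Definition equivariant (rho : Cn -> Cn) (D : set Cn) (f : Cn -> Cn) : Prop :=
  forall u z, torus u -> D z -> f (cmul u z) = cmul (rho u) (f z).

Definition mu_Cn (z : Cn) : 'rV[R]_n :=
  \row_k complex.Re (`|zcoord z k| ^+ 2).

(* The value of [1/(2 pi sqrt(-1)) \sum_k dz_k /\ d\bar z_k] on the tangent
   vectors [v], [w], where [(a /\ b)(v, w) = a(v) b(w) - a(w) b(v)]. *)
Definition omega_Cn_val (v w : 'rV[R]_(n + n)) : R[i] :=
  ((2 * pi)%:C%C * 'i)^-1 *
  \sum_k (zcoord v k * (zcoord w k)^* - zcoord w k * (zcoord v k)^*).

Lemma omega_Cn_val_real (v w : 'rV[R]_(n + n)) : omega_Cn_val v w \is Num.real.
Proof.
apply/CrealP; rewrite /omega_Cn_val rmorphM /= fmorphV rmorphM /= conjCi.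
have -> : Num.conj ((2 * pi)%:C%C : R[i]) = (2 * pi)%:C%C.
  by apply: conj_Creal; rewrite complex_real.
rewrite mulrN invrN mulNr -mulrN rmorph_sum -sumrN; congr (_ * _).
by apply: eq_bigr => k _; rewrite rmorphB !rmorphM /= !conjCK opprB mulrC (mulrC (zcoord w k)).
Qed.

Definition omega_Cn : two_form Cn := fun _ _ =>
  \matrix_(a, b) complex.Re (omega_Cn_val (delta_mx 0 a) (delta_mx 0 b)).

End ComplexSpace.

Section LocallyToric.
Context {R : realType} {n : nat}.
Variables (X : manifold [set: 'rV[R]_(n + n)]) (omega : two_form X).
Variables (B : manifold (orthant R n)) (mu : X -> B).

(* A triple (U, phi^B, phi^X), with the inverse of phi^X. *)
Record local_identification := LocalIdentification {
  lid_chart : chart (orthant R n) B;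
  lid_map : X -> @Cn R n;
  lid_inv : @Cn R n -> X;
  lid_chart_smooth : smooth_chart lid_chart;
  lid_symplectomorphism :
    symplectomorphism omega omega_Cn
      (mu @^-1` chart_dom lid_chart) (mu_Cn @^-1` (lid_chart @` chart_dom lid_chart))
      lid_map lid_inv;
  lid_comm : forall x, chart_dom lid_chart (mu x) ->
    mu_Cn (lid_map x) = lid_chart (mu x)
}.

Definition lid_dom (L : local_identification) : set B := chart_dom (lid_chart L).

Definition local_identification_system (I : Type) (L : I -> local_identification)
    : Prop :=
  \bigcup_i lid_dom (L i) = [set: B].

Definition locally_toric_fibration : Prop :=
  smooth_map [set: X] mu /\
  exists (I : Type) (L : I -> local_identification),
    local_identification_system L.

End LocallyToric.

(* Main.v *)
Require Import Defs.
From HB Require Import structures.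
From mathcomp Require Import all_boot all_order all_algebra.
From mathcomp Require Import complex.
From mathcomp Require Import all_classical all_reals all_analysis.
From mathcomp Require Import ring lra.

(** Over the overlap, [f = phi_a o phi_b^-1] is a symplectic map of invariant
open subsets of C^n that covers a map [h] of open subsets of the orthant.  The
component functions [mu_k] of [mu_Cn] generate the standard torus action:
the Hamiltonian flow of [\sum_k s_k mu_k] is, up to a constant factor in time,
rotation with speeds [s].  As [f] is symplectic, it carries the flow of
[H_s = \sum_k s_k (mu_k o f)] to that rotation.  Where all coordinates are
nonzero, [H_s] is a function of [mu], so its flow is rotation with the constant
speeds [s A(z)], where [A(z)] is the Jacobian matrix of [h] at [mu z].  Hence
[f (e^(i t s A(z)) z) = e^(i t s) f z] ([base_diff_flow]).

At time [2 pi] and [s] a basis vector the right hand side is [f z], and [f] is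
injective, so the entries of [A(z)] are integers ([base_diff_int]).  They are
also continuous in [z], because [f] is of class [C^1], and depend only on
[mu z]; thus they are constant near each point of the base, corners included,
and constant on the whole base because it is connected ([base_constant]).  The
points with nonzero coordinates are dense, and one integer matrix [A]
satisfies [f (e^(i s A) z) = e^(i s) f z] everywhere ([fibred_equivariant]).

The same applies to the inverse of [f] and gives an integer matrix [C] with
[f (e^(i s) z) = e^(i s C) f z].  Comparing the two at a point with nonzero
coordinates shows [A C = 1] ([lattice_inverse]), so that [e^(i s) |-> e^(i s C)]
is an automorphism of the torus, given by Laurent monomials
([torus_aut_monomial]).

That [f] carries one flow to the other is obtained from a linear equation: the
image [c] under [f] of an orbit of a one-parameter group of rotations satisfies
[c' = i s c], whose solutions are rotations ([rot_ode]). *)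

Set Implicit Arguments.
Unset Strict Implicit.
Unset Printing Implicit Defensive.
Import Order.TTheory GRing.Theory Num.Theory.
Import numFieldNormedType.Exports.
Local Open Scope classical_set_scope.
Local Open Scope ring_scope.

(** * Angles *)

Section Angles.
Context {R : realType}.
Implicit Types x y t : R.

Lemma circle_param x y : x ^+ 2 + y ^+ 2 = 1 -> exists t, x = cos t /\ y = sin t.
Proof.
move=> xy1.
have x1 : -1 <= x <= 1 by apply/andP; split; nra.
have cosx : cos (acos x) = x by rewrite acosK // in_itv.
have := sin_acos x1; have -> : 1 - x ^+ 2 = y ^+ 2 by rewrite -xy1 addrC addKr.
rewrite sqrtr_sqr; case: (leP 0 y) => [y0|/ltW y0] sinx.
  by exists (acos x); rewrite cosx sinx ger0_norm.
by exists (- acos x); rewrite cosN sinN cosx sinx ler0_norm // opprK.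
Qed.

Lemma periodicz (f : R -> R) T t (m : int) :
  @periodic R R f T -> f (t + m%:~R * T) = f t.
Proof.
move=> fT; case: m => m; first by rewrite mulr_natl periodicn.
rewrite NegzE mulrNz mulNr mulr_natl -[in RHS](subrK (T *+ m.+1) t).
by rewrite [RHS]periodicn.
Qed.

(** Subtracting the integer part of [a] reduces to an angle in [[0, 2 pi[], and
[cos] is injective on [[0, pi]]; angles in the upper half are reflected by
[t |-> 2 pi - t]. *)
Lemma cos_eq1_int (a : R) : cos (a * (pi *+ 2)) = 1 -> exists m : int, a = m%:~R.
Proof.
move=> ca1; exists (Num.floor a).
set b := a - (Num.floor a)%:~R.
have /andP[b0 b1] : 0 <= b < 1.
  by have := floorD1_gt a; rewrite intrD subr_ge0 floor_le ltrBlDr addrC.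
have cb : cos (b * (pi *+ 2)) = 1 by rewrite mulrBl -mulNr -mulrNz (periodicz _ _ (@cosD2pi R)).
have pi0 := pi_gt0 R.
suff : b = 0 by move/subr0_eq.
have [bh|bh] := leP (b * (pi *+ 2)) pi.
  have : b * (pi *+ 2) = 0.
    apply: cos_inj; rewrite ?in_itv /= ?lexx ?(ltW pi0) ?cos0 //.
    by rewrite bh andbT mulr_ge0 // mulrn_wge0 // ltW.
  by move/eqP; rewrite mulf_eq0 mulrn_eq0 /= (gt_eqF pi0) orbF => /eqP.
suff : pi *+ 2 - b * (pi *+ 2) = 0 by nra.
apply: cos_inj; rewrite ?in_itv /= ?lexx ?(ltW pi0) //.
  by apply/andP; split; nra.
by rewrite cosB cos2pi sin2pi cb mul0r mulr1 addr0 cos0.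
Qed.

End Angles.

(** * Rotations of C^n *)

Section Rotations.
Context {R : realType} {n : nat}.
Implicit Types (s a : 'rV[R]_n) (z v : 'rV[R]_(n + n)) (k j : 'I_n).

Definition xcoord z k : R := z 0 (lshift n k).
Definition ycoord z k : R := z 0 (rshift n k).

Lemma xy_ext z v : xcoord z =1 xcoord v -> ycoord z =1 ycoord v -> z = v.
Proof.
move=> ex ey; apply/rowP => p; rewrite -[p]fintype.splitK.
by case: (fintype.split p) => k /=; [exact: ex | exact: ey].
Qed.

Lemma sum_xy (F : 'I_(n + n) -> R) :
  \sum_p F p = \sum_k (F (lshift n k) + F (rshift n k)).
Proof. by rewrite big_split_ord big_split. Qed.

(** Row vectors are multiplied by matrices on the right, so complex
multiplications are written as right multiplications: [scalemx a] multiplies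
the [k]-th complex coordinate by the real number [a_k] and [imx] multiplies all
of them by [i]. *)
Definition scalemx a : 'M[R]_(n + n) := diag_mx (row_mx a a).
Definition imx : 'M[R]_(n + n) := block_mx 0 1%:M (- 1%:M) 0.
(** The infinitesimal rotation with speeds [a]: multiplication by [i a_k] on the
[k]-th coordinate. *)
Definition rotgen a := scalemx a *m imx.
(** The action of the torus element with coordinates [e^(i s_k)]. *)
Definition rotmx s := scalemx (map_mx cos s) + rotgen (map_mx sin s).

Lemma xcoord_scale z a k : xcoord (z *m scalemx a) k = a 0 k * xcoord z k.
Proof. by rewrite /xcoord mul_mx_diag mxE row_mxEl mulrC. Qed.

Lemma ycoord_scale z a k : ycoord (z *m scalemx a) k = a 0 k * ycoord z k.
Proof. by rewrite /ycoord mul_mx_diag mxE row_mxEr mulrC. Qed.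

Lemma mul_imx z : z *m imx = row_mx (- rsubmx z) (lsubmx z).
Proof.
rewrite -{1}(hsubmxK z) mul_row_block !mulmx0 add0r addr0 mulmx1.
by rewrite mulmxN mulmx1.
Qed.

Lemma xcoord_imx z k : xcoord (z *m imx) k = - ycoord z k.
Proof. by rewrite /xcoord mul_imx row_mxEl !mxE. Qed.

Lemma ycoord_imx z k : ycoord (z *m imx) k = xcoord z k.
Proof. by rewrite /ycoord mul_imx row_mxEr !mxE. Qed.

Lemma xcoordN z k : xcoord (- z) k = - xcoord z k. Proof. by rewrite /xcoord mxE. Qed.
Lemma ycoordN z k : ycoord (- z) k = - ycoord z k. Proof. by rewrite /ycoord mxE. Qed.

Lemma imx_sqr : imx *m imx = - 1%:M.
Proof.
apply/row_matrixP => i; rewrite !rowE mulmxA mulmxN mulmx1.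
by apply: xy_ext => k; rewrite !(xcoord_imx, ycoord_imx, xcoordN, ycoordN).
Qed.

Lemma xcoordD z v k : xcoord (z + v) k = xcoord z k + xcoord v k. Proof. by rewrite /xcoord mxE. Qed.
Lemma ycoordD z v k : ycoord (z + v) k = ycoord z k + ycoord v k. Proof. by rewrite /ycoord mxE. Qed.

Lemma xcoord_gen z a k : xcoord (z *m rotgen a) k = - (a 0 k * ycoord z k).
Proof. by rewrite mulmxA xcoord_imx ycoord_scale. Qed.

Lemma ycoord_gen z a k : ycoord (z *m rotgen a) k = a 0 k * xcoord z k.
Proof. by rewrite mulmxA ycoord_imx xcoord_scale. Qed.

Lemma xcoord_rot z s k :
  xcoord (z *m rotmx s) k = cos (s 0 k) * xcoord z k - sin (s 0 k) * ycoord z k.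
Proof. by rewrite mulmxDr xcoordD xcoord_scale xcoord_gen !mxE. Qed.

Lemma ycoord_rot z s k :
  ycoord (z *m rotmx s) k = cos (s 0 k) * ycoord z k + sin (s 0 k) * xcoord z k.
Proof. by rewrite mulmxDr ycoordD ycoord_scale ycoord_gen !mxE. Qed.

Lemma rotmxD s s' z : z *m rotmx (s + s') = z *m rotmx s *m rotmx s'.
Proof.
by apply: xy_ext => k; rewrite !(xcoord_rot, ycoord_rot) mxE cosD sinD; ring.
Qed.

Lemma rotmx0 z : z *m rotmx 0 = z.
Proof. by apply: xy_ext => k; rewrite !(xcoord_rot, ycoord_rot) mxE cos0 sin0; ring. Qed.

Lemma scale_rot z a s : z *m rotmx s *m scalemx a = z *m scalemx a *m rotmx s.
Proof.
by apply: xy_ext => k; rewrite !(xcoord_rot, ycoord_rot, xcoord_scale, ycoord_scale); ring.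
Qed.

Lemma mu_CnE z k : mu_Cn z 0 k = xcoord z k ^+ 2 + ycoord z k ^+ 2.
Proof. by rewrite mxE -add_Re2_Im2. Qed.

Lemma mu_rot z s : mu_Cn (z *m rotmx s) = mu_Cn z.
Proof.
apply/rowP => k; rewrite !mu_CnE xcoord_rot ycoord_rot.
have := cos2Dsin2 (s 0 k); set c := cos _; set d := sin _ => cd.
by transitivity ((c ^+ 2 + d ^+ 2) * (xcoord z k ^+ 2 + ycoord z k ^+ 2));
  [ring | rewrite cd mul1r].
Qed.

Lemma mu_Cn_ge0 z : orthant R n (mu_Cn z).
Proof. by move=> k; rewrite mu_CnE addr_ge0 ?sqr_ge0. Qed.

End Rotations.
Arguments imx {R n}.

(** * The symplectic form and the torus *)

Section Symplectic.
Context {R : realType} {n : nat}.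
Implicit Types (s a : 'rV[R]_n) (z v w : 'rV[R]_(n + n)) (J : 'M[R]_(n + n)).

Lemma omega_Cn_valE v w :
  complex.Re (omega_Cn_val v w) = - pi^-1 * (v *m imx *m w^T) 0 0.
Proof.
have pi0 : (pi : R) != 0 by rewrite gt_eqF // pi_gt0.
rewrite mxE sum_xy mulr_sumr /omega_Cn_val.
have -> : \sum_k (zcoord v k * (zcoord w k)^* - zcoord w k * (zcoord v k)^*) =
  (\sum_k (ycoord v k * xcoord w k - xcoord v k * ycoord w k))%:C%C * (2%:C%C * 'i).
  rewrite rmorph_sum mulr_suml; apply: eq_bigr => k _.
  rewrite /zcoord -/(xcoord v k) -/(ycoord v k) -/(xcoord w k) -/(ycoord w k).
  apply/eqP; rewrite eq_complex /=; apply/andP; split; apply/eqP; ring.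
have -> : ((2 * pi)%:C%C * 'i)^-1 = (pi^-1)%:C%C * (2%:C%C * 'i)^-1 :> R[i].
  rewrite rmorphM /= mulrAC invfM mulrC; congr (_ * _).
  by rewrite fmorphV.
rewrite mulrACA [X in _ * X]mulVf ?mulr1; last first.
  by rewrite mulf_neq0 ?neq0Ci // fmorph_eq0 pnatr_eq0.
rewrite -rmorphM /= mulr_sumr; apply: eq_bigr => k _.
rewrite ![w^T _ _]mxE -/(xcoord (v *m imx) k) -/(ycoord (v *m imx) k) xcoord_imx ycoord_imx.
by rewrite -/(xcoord w k) -/(ycoord w k); ring.
Qed.

(** The standard form is [imx] up to a nonzero constant, which cancels when two
pullbacks are compared. *)
Lemma omega_CnE (i : atlas_index (@Cn R n)) x : omega_Cn i x = - pi^-1 *: imx.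
Proof.
apply/matrixP => a b; rewrite !mxE omega_Cn_valE; congr (_ * _).
by rewrite -rowE trmx_delta -colE !mxE.
Qed.

Lemma congruence_cancel (K : fieldType) m (P J S : 'M[K]_m) : P \in unitmx ->
  P *m S *m P^T = P *m J *m S *m (P *m J)^T -> J *m S *m J^T = S.
Proof.
move=> Pu E; have Ptu : P^T \in unitmx by rewrite unitmx_tr.
apply: (can_inj (mulmxK Ptu)); apply: (can_inj (mulKmx Pu)).
by rewrite !mulmxA E trmx_mul !mulmxA.
Qed.

(** The transpose of a symplectic matrix is symplectic: [- J imx] and [J^T imx]
are inverse to each other on one side, hence on both. *)
Lemma symplectic_tr J : J *m imx *m J^T = imx -> J^T *m imx *m J = imx.
Proof.
move=> JJ.
have : (- (J *m imx)) *m (J^T *m imx) = 1%:M.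
  by rewrite mulNmx mulmxA JJ imx_sqr opprK.
move/mulmx1C; rewrite mulmxN mulmxA => H.
have := congr1 (mulmx^~ imx) H; rewrite /= mul1mx mulNmx -(mulmxA _ imx imx) imx_sqr.
by rewrite mulmxN opprK mulmx1.
Qed.

(** Symplectic maps preserve Hamiltonian vectors: [w *m scalemx s *m J^T] is half
the gradient at [z] of the quadratic function [\sum_k s_k mu_k] composed with a
map that has value [w] and Jacobian [J] at [z], and multiplication by [imx]
turns half gradients into Hamiltonian vectors, up to a common factor. *)
Lemma symplectic_gen J s a z w : J *m imx *m J^T = imx ->
  w *m scalemx s *m J^T = z *m scalemx a -> z *m rotgen a *m J = w *m rotgen s.
Proof.
move=> JJ e; transitivity (w *m scalemx s *m (J^T *m imx *m J)).
  by rewrite !mulmxA e.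
by rewrite symplectic_tr // -mulmxA.
Qed.

(** The torus element [e^(i s)]. *)
Definition expt s : @Cn R n :=
  of_zcoord (fun k => (cos (s 0 k) +i* sin (s 0 k))%C).

Lemma zcoord_of (c : 'I_n -> R[i]) k : zcoord (of_zcoord c) k = c k.
Proof. by rewrite /zcoord row_mxEl row_mxEr !mxE; case: (c k). Qed.

Lemma zcoord_inj z v : zcoord z =1 zcoord v -> z = v.
Proof. by move=> e; apply: xy_ext => k; case: (e k). Qed.

Lemma cmul_expt s z : cmul (expt s) z = z *m rotmx s.
Proof.
apply: zcoord_inj => k; rewrite !zcoord_of {2}/zcoord.
rewrite -/(xcoord _ _) -/(ycoord _ _) xcoord_rot ycoord_rot /=.
by [].
Qed.

Lemma torusE (u : @Cn R n) : torus u <-> exists s, u = expt s.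
Proof.
split=> [Tu|[s ->]]; last first.
  by move=> k; rewrite zcoord_of normc_def /= cos2Dsin2 sqrtr1.
have /choice[s us] : forall k, exists t, xcoord u k = cos t /\ ycoord u k = sin t.
  move=> k; apply: circle_param; have := Tu k.
  move/(congr1 (fun x => x ^+ 2)); rewrite -add_Re2_Im2 expr1n /=.
  by case.
exists (\row_k s k); apply: zcoord_inj => k; rewrite zcoord_of mxE /zcoord.
by case: (us k) => <- <-.
Qed.

Lemma cmul_exptD s a : cmul (expt s) (expt a) = expt (s + a).
Proof.
apply: zcoord_inj => k; rewrite !zcoord_of mxE cosD sinD.
by rewrite -[RHS]/(_ +i* _)%C [_ + _ * sin _]addrC.
Qed.
End Symplectic.

(** * Calculus on row vectors *)

Section Calculus.
Context {R : realType}.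

(** A map into row vectors is the sum of its coordinates times the basis vectors. *)
Lemma differentiable_rV {V : normedModType R} m (F : V -> 'rV[R]_m) x :
  (forall i, differentiable (fun y => F y 0 i) x) -> differentiable F x.
Proof.
move=> dF.
have -> : F = \sum_(i < m) (fun y => F y 0 i *: delta_mx 0 i).
  by apply/funext => y; rewrite fct_sumE [LHS]row_sum_delta.
by apply: differentiable_sum => i; exact: differentiableZl.
Qed.

Lemma is_derive_coord {V : normedModType R} m (F : V -> 'rV[R]_m) t v (dF : 'rV[R]_m) i :
  is_derive t v F dF -> is_derive t v (fun y => F y 0 i) (dF 0 i).
Proof.
move=> [Fd <-]; split; first by move/derivable_mxP: Fd.
by rewrite derive_mx // mxE.
Qed.

Lemma is_derive_rV {V : normedModType R} m (F : V -> 'rV[R]_m) t v (dF : 'rV[R]_m) :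
  (forall i, is_derive t v (fun y => F y 0 i) (dF 0 i)) -> is_derive t v F dF.
Proof.
move=> Fi.
have Fd : derivable F t v.
  by apply/derivable_mxP => j i; rewrite (ord1 j); case: (Fi i).
split=> //; rewrite derive_mx //; apply/rowP => i; rewrite mxE.
by case: (Fi i).
Qed.

Lemma mulmxr_continuous m p (U : 'M[R]_(m, p)) :
  continuous (mulmxr U : 'rV[R]_m -> 'rV[R]_p).
Proof.
move=> z; apply: differentiable_continuous; apply: differentiable_rV => i.
rewrite (_ : (fun y => _) = \sum_(j < m) (U j i \*: (fun y : 'rV[R]_m => y 0 j))).
  apply: differentiable_sum => j; apply: differentiableZ.
  exact: differentiable_coord.
apply/funext => y; rewrite fct_sumE /= mxE.
by apply: eq_bigr => j _; rewrite mulrC.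
Qed.

Lemma is_derive_comp_jacobian m p (f : 'rV[R]_m -> 'rV[R]_p) (c : R -> 'rV[R]_m) t dc :
  differentiable f (c t) -> is_derive t 1 c dc ->
  is_derive t 1 (f \o c) (dc *m 'J f (c t)).
Proof.
move=> fd [/derivable1_diffP cd <-].
split; first exact/derivable1_diffP/differentiable_comp.
rewrite deriveE; last exact: differentiable_comp.
by rewrite diff_comp //= -deriveEjacobian // -!deriveE.
Qed.

Lemma jacobian_comp m p q (f : 'rV[R]_m -> 'rV[R]_p) (g : 'rV[R]_p -> 'rV[R]_q) z :
  differentiable f z -> differentiable g (f z) ->
  'J (g \o f) z = 'J f z *m 'J g (f z).
Proof.
move=> fd gd; have gfd := differentiable_comp fd gd.
apply/row_matrixP => i; rewrite !rowE mulmxA.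
rewrite -(deriveEjacobian _ gfd) -(deriveEjacobian _ fd) -(deriveEjacobian _ gd).
by rewrite (deriveE _ gfd) (deriveE _ fd) (deriveE _ gd) diff_comp.
Qed.

(** The candidate differential of [g] is that of [f]; the choice made in the
definition of the differential then picks some valid one. *)
Lemma near_eq_differentiable (V W : normedModType R) (f g : V -> W) z :
  (\near z, f z = g z) -> differentiable f z -> differentiable g z.
Proof.
move=> fg fd.
have [dfc /eqaddoP dfo] : continuous ('d f z) /\ f = (cst (f (lim (nbhs z))) + 'd f z \o center (lim (nbhs z)))
    +o_ z (center (lim (nbhs z))) by case: fd.
have fgz := nbhs_singleton fg.
apply/diffP => /=.
apply: (@getPex _ (fun (df : {linear V -> W}) => continuous df /\
  forall y, g y = g (lim (nbhs z)) + df (y - lim (nbhs z))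
                  +o_(y \near z) (y - lim (nbhs z)))).
exists ('d f z); split => // y.
have key : g = (fun y => g (lim (nbhs z)) + 'd f z (y - lim (nbhs z)))
    +o_ z (fun y => y - lim (nbhs z)).
  apply/eqaddoP => e e0; apply: filterS2 fg (dfo e e0) => x.
  by rewrite !fctE lim_id // fgz => ->.
exact: (congr1 (fun h => h y) key).
Qed.

Lemma near_eq_jacobian m p (f g : 'rV[R]_m -> 'rV[R]_p) z :
  (\near z, f z = g z) -> differentiable f z -> 'J f z = 'J g z.
Proof.
move=> fg fd; have gd := near_eq_differentiable fg fd.
apply/row_matrixP => i; rewrite [LHS]rowE [RHS]rowE.
have := near_eq_derive (delta_mx 0 i) fg.
by rewrite (deriveEjacobian _ fd) (deriveEjacobian _ gd).
Qed.

Lemma is_derive_line m (z v : 'rV[R]_m) (t : R) :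
  is_derive t 1 (fun t : R => z + t *: v) v.
Proof.
apply: is_derive_rV => i.
rewrite (_ : (fun y => _) = fun t => z 0 i + t * v 0 i); last first.
  by apply/funext => r; rewrite !mxE.
by apply: is_derive_eq; rewrite /GRing.scale /=; ring.
Qed.

Lemma is_derive1_continuous {W : normedModType R} (c : R -> W) (t : R) dc :
  is_derive t 1 c dc -> {for t, continuous c}.
Proof. by move=> [cd _]; exact/differentiable_continuous/derivable1_diffP. Qed.

End Calculus.

Section Paths.
Context {R : realType} {n : nat}.
Implicit Types (s a : 'rV[R]_n) (z v w : 'rV[R]_(n + n)).

Lemma is_derive_rot z s (t : R) :
  is_derive t 1 (fun t : R => z *m rotmx (t *: s)) (z *m rotmx (t *: s) *m rotgen s).
Proof.
apply: is_derive_rV => p; rewrite -[p]fintype.splitK.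
case: (fintype.split p) => k /=.
  rewrite -/(xcoord (_ *m rotgen s) k) xcoord_gen ycoord_rot.
  rewrite (_ : (fun y => _) = fun t => cos (t * s 0 k) * xcoord z k - sin (t * s 0 k) * ycoord z k); last first.
    by apply/funext => y; rewrite -/(xcoord (_ *m _) k) xcoord_rot !mxE.
  apply: is_derive_eq; rewrite mxE /GRing.scale /=; ring.
rewrite -/(ycoord (_ *m rotgen s) k) ycoord_gen xcoord_rot.
rewrite (_ : (fun y => _) = fun t => cos (t * s 0 k) * ycoord z k + sin (t * s 0 k) * xcoord z k); last first.
  by apply/funext => y; rewrite -/(ycoord (_ *m _) k) ycoord_rot !mxE.
apply: is_derive_eq; rewrite mxE /GRing.scale /=; ring.
Qed.

(** Rotating [c t] back by [t *: s] gives a curve with zero derivative. *)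
Lemma rot_ode (c : R -> 'rV[R]_(n + n)) s :
  (forall t : R, is_derive t 1 c (c t *m rotgen s)) ->
  forall t, c t = c 0 *m rotmx (t *: s).
Proof.
move=> cd t.
suff H : c t *m rotmx (- (t *: s)) = c 0.
  by rewrite -H -rotmxD addNr rotmx0.
have xd k r := is_derive_coord (lshift n k) (cd r).
have yd k r := is_derive_coord (rshift n k) (cd r).
apply: xy_ext => k.
  pose p r := cos (r * s 0 k) * xcoord (c r) k + sin (r * s 0 k) * ycoord (c r) k.
  have -> : xcoord (c 0) k = p 0 by rewrite /p mul0r cos0 sin0; ring.
  transitivity (p t); first by rewrite xcoord_rot !mxE cosN sinN /p; ring.
  apply: is_derive_0_is_cst => r.
  have := xd k r; have := yd k r.
  rewrite -/(xcoord (_ *m rotgen s) k) -/(ycoord (_ *m rotgen s) k) xcoord_gen ycoord_gen => ? ?.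
  rewrite /p /xcoord /ycoord; apply: is_derive_eq.
  by rewrite /GRing.scale /= /xcoord /ycoord; ring.
pose p r := cos (r * s 0 k) * ycoord (c r) k - sin (r * s 0 k) * xcoord (c r) k.
have -> : ycoord (c 0) k = p 0 by rewrite /p mul0r cos0 sin0; ring.
transitivity (p t); first by rewrite ycoord_rot !mxE cosN sinN /p; ring.
apply: is_derive_0_is_cst => r.
have := xd k r; have := yd k r.
rewrite -/(xcoord (_ *m rotgen s) k) -/(ycoord (_ *m rotgen s) k) xcoord_gen ycoord_gen => ? ?.
rewrite /p /xcoord /ycoord; apply: is_derive_eq.
by rewrite /GRing.scale /= /xcoord /ycoord; ring.
Qed.

End Paths.

(** * The integral matrix attached to a symplectic map over a base *)

Section Fibred.
Context {R : realType} {n : nat}.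
Implicit Types (s a : 'rV[R]_n) (z v w : 'rV[R]_(n + n)) (k j : 'I_n) (t : R).

(** The properties of a transition map that the argument needs, on the invariant
set [mu_Cn @^-1` V].  By [fibred_mu] the functions [mu_k o f] are invariant
under the torus.  In [fibred_symp] the form is represented by [imx], which is
[omega_Cn] up to a constant factor. *)
Record fibred_symplectic (V : set 'rV[R]_n)
    (f : 'rV[R]_(n + n) -> 'rV[R]_(n + n)) : Prop := FibredSymplectic {
  fibred_open : exists2 W : set 'rV[R]_n, open W & V = W `&` orthant R n;
  fibred_diff : forall z, V (mu_Cn z) -> differentiable f z;
  fibred_C1 : forall z p q, V (mu_Cn z) -> {for z, continuous (fun y => 'J f y p q)};
  fibred_symp : forall z, V (mu_Cn z) -> 'J f z *m imx *m ('J f z)^T = imx;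
  fibred_inj : forall z w, V (mu_Cn z) -> V (mu_Cn w) -> f z = f w -> z = w;
  fibred_mu : forall z w, V (mu_Cn z) -> mu_Cn z = mu_Cn w ->
    mu_Cn (f z) = mu_Cn (f w)
}.

(** Half the derivative of [mu_k] at [z] in the direction [w]. *)
Definition dotk k z w : R := xcoord z k * xcoord w k + ycoord z k * ycoord w k.

Lemma dotkDr k z v w : dotk k z (v + w) = dotk k z v + dotk k z w.
Proof. by rewrite /dotk xcoordD ycoordD; ring. Qed.

Lemma dotkZr k z (c : R) w : dotk k z (c *: w) = c * dotk k z w.
Proof. by rewrite /dotk /xcoord /ycoord !mxE; ring. Qed.

Lemma is_derive_mu {U : normedModType R} (F : U -> 'rV[R]_(n + n)) (t v : U) dF k :
  is_derive t v F dF ->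
  is_derive t v (fun y => mu_Cn (F y) 0 k) (2 * dotk k (F t) dF).
Proof.
move=> Fd; rewrite (_ : (fun y => _) =
  (fun y => F y 0 (lshift n k)) * (fun y => F y 0 (lshift n k)) +
  (fun y => F y 0 (rshift n k)) * (fun y => F y 0 (rshift n k))); last first.
  by apply/funext => y; rewrite mu_CnE.
have dx := is_derive_coord (lshift n k) Fd.
have dy := is_derive_coord (rshift n k) Fd.
apply: (is_derive_eq (is_deriveD (is_deriveM dx dx) (is_deriveM dy dy))).
rewrite /dotk /xcoord /ycoord /GRing.scale /=; ring.
Qed.

Lemma mu_continuous : continuous (@mu_Cn R n : 'rV[R]_(n + n) -> 'rV[R]_n).
Proof.
move=> z; apply: differentiable_continuous; apply: differentiable_rV => k.
rewrite (_ : (fun y => _) =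
  (fun y : 'rV[R]_(n + n) => y 0 (lshift n k)) * (fun y => y 0 (lshift n k)) +
  (fun y => y 0 (rshift n k)) * (fun y => y 0 (rshift n k))); last first.
  by apply/funext => y; rewrite mu_CnE.
by apply: differentiableD; apply: differentiableM; exact: differentiable_coord.
Qed.

Lemma mu_Cn_near (V : set 'rV[R]_n) z :
  (exists2 W : set 'rV[R]_n, open W & V = W `&` orthant R n) ->
  V (mu_Cn z) -> \forall w \near z, V (mu_Cn w).
Proof.
move=> [W Wo ->] [Wz _].
have Ww : \forall w \near z, W (mu_Cn w).
  by apply: (@mu_continuous z W); exact: open_nbhs_nbhs.
by apply: filterS Ww => w Ww; split=> //; exact: mu_Cn_ge0.
Qed.

Lemma mul_scale_delta z j (J : 'M[R]_(n + n)) :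
  z *m scalemx (delta_mx 0 j) *m J =
  xcoord z j *: row (lshift n j) J + ycoord z j *: row (rshift n j) J.
Proof.
rewrite !rowE !scalemxAl -mulmxDl; congr (_ *m _).
apply: xy_ext => k; rewrite !(xcoordD, ycoordD, xcoord_scale, ycoord_scale) /xcoord /ycoord !mxE.
  rewrite eqxx /= eq_lshift eq_lrshift /= mulr0 addr0.
  by case: eqVneq => [->|]; rewrite ?mulr1 ?mul1r ?mulr0 ?mul0r.
rewrite eqxx /= eq_rlshift eq_rshift /= mulr0 add0r.
by case: eqVneq => [->|]; rewrite ?mulr1 ?mul1r ?mulr0 ?mul0r.
Qed.

Lemma mul_rotgen_delta z j (J : 'M[R]_(n + n)) :
  z *m rotgen (delta_mx 0 j) *m J =
  - ycoord z j *: row (lshift n j) J + xcoord z j *: row (rshift n j) J.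
Proof.
rewrite -xcoord_imx -(ycoord_imx z) -mul_scale_delta; congr (_ *m _).
by apply: xy_ext => k; rewrite ?(xcoord_gen, ycoord_gen) !(xcoord_scale, ycoord_scale, xcoord_imx, ycoord_imx) ?mulrN.
Qed.

Variables (V : set 'rV[R]_n) (f : 'rV[R]_(n + n) -> 'rV[R]_(n + n)).
Hypothesis fV : fibred_symplectic V f.

(** Half the derivative of [mu_k o f] in the direction of the [j]-th coordinate
of [z]. *)
Definition radial z k j := dotk k (f z) (z *m scalemx (delta_mx 0 j) *m 'J f z).
(** The Jacobian matrix [d (mu_k o f) / d mu_j] of the covered map, computed
upstairs: the radial direction above changes [mu_j] at the rate [2 mu_j] and no
other [mu_l].  Meaningful where all coordinates of [z] are nonzero. *)
Definition base_diff z : 'M[R]_n := \matrix_(k, j) (radial z k j / mu_Cn z 0 j).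

(** Differentiating at [0] the function [mu_k o f] along the rotation of the
[j]-th coordinate, on which it is constant. *)
Lemma tangential0 z k j : V (mu_Cn z) ->
  dotk k (f z) (z *m rotgen (delta_mx 0 j) *m 'J f z) = 0.
Proof.
move=> Vz; set s := delta_mx 0 j.
have d0 := is_derive_rot z s 0.
rewrite scale0r rotmx0 in d0.
have fd : differentiable f (z *m rotmx (0 *: s)).
  by rewrite scale0r rotmx0; exact: (fibred_diff fV).
have := is_derive_mu k (is_derive_comp_jacobian fd d0).
rewrite /comp /= scale0r rotmx0.
rewrite (_ : (fun y => _) = cst (mu_Cn (f z) 0 k)); last first.
  apply/funext => t /=; rewrite (@fibred_mu _ _ fV _ z) ?mu_rot //.
by move=> [_]; rewrite derive_cst => /esym/eqP; rewrite mulf_eq0 pnatr_eq0 /= => /eqP.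
Qed.

(** The lines through [z] and through its rotation, in corresponding radial
directions, are rotations of each other, and [mu_k o f] takes the same values
along them. *)
Lemma radial_rot z s k j : V (mu_Cn z) -> radial (z *m rotmx s) k j = radial z k j.
Proof.
move=> Vz; rewrite /radial scale_rot; set v := z *m scalemx _.
have Vzs : V (mu_Cn (z *m rotmx s)) by rewrite mu_rot.
have fd : differentiable f (z + 0 *: v) by rewrite scale0r addr0; exact: (fibred_diff fV).
have fds : differentiable f (z *m rotmx s + 0 *: (v *m rotmx s)).
  by rewrite scale0r addr0; exact: (fibred_diff fV).
have := is_derive_mu k (is_derive_comp_jacobian fd (is_derive_line z v 0)).
have := is_derive_mu k (is_derive_comp_jacobian fds (is_derive_line (z *m rotmx s) (v *m rotmx s) 0)).
rewrite /comp /= !scale0r !addr0 => ds d.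
have [_ e1] := ds.
have [_ e2] : is_derive (0 : R) 1
    (fun y => mu_Cn (f (z *m rotmx s + y *: (v *m rotmx s))) 0 k)
    (2 * dotk k (f z) (v *m 'J f z)).
  apply: near_eq_is_derive d.
  have zc : {for 0, continuous (fun t : R => z + t *: v)}.
    exact: is_derive1_continuous (is_derive_line z v 0).
  have Vt : \forall t \near (0 : R), V (mu_Cn (z + t *: v)).
    apply: (zc [set y | V (mu_Cn y)]).
    by rewrite scale0r addr0; exact: mu_Cn_near (fibred_open fV) Vz.
  apply: filterS Vt => t Vt.
  by rewrite scalemxAl -mulmxDl (@fibred_mu _ _ fV _ ((z + t *: v) *m rotmx s)) ?mu_rot.
have : (2 : R) != 0 by rewrite pnatr_eq0.
by move=> two0; apply: (mulfI two0); exact: etrans (esym e1) e2.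
Qed.

Lemma base_diff_rot z s : V (mu_Cn z) -> base_diff (z *m rotmx s) = base_diff z.
Proof. by move=> Vz; apply/matrixP => k j; rewrite [LHS]mxE [RHS]mxE radial_rot // mu_rot. Qed.

Definition free_point z := forall k, mu_Cn z 0 k != 0.

Lemma free_point_rot z s : free_point z -> free_point (z *m rotmx s).
Proof. by move=> zf k; rewrite mu_rot. Qed.

(** The tangential derivative vanishes, so the gradient of [mu_k o f] in the plane
of the [j]-th coordinate is radial. *)
Lemma base_diffP z k j : V (mu_Cn z) -> free_point z ->
  dotk k (f z) (row (lshift n j) ('J f z)) = base_diff z k j * xcoord z j /\
  dotk k (f z) (row (rshift n j) ('J f z)) = base_diff z k j * ycoord z j.
Proof.
move=> Vz /(_ j); have := tangential0 k j Vz.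
rewrite mul_rotgen_delta [base_diff _ _ _]mxE /radial mul_scale_delta !dotkDr !dotkZr mu_CnE.
set P := dotk _ _ _; set Q := dotk _ _ _ => tan N0.
split; apply/(mulfI N0); rewrite mulrA mulrCA mulfV // mulr1.
  have -> : (xcoord z j ^+ 2 + ycoord z j ^+ 2) * P =
    (xcoord z j * P + ycoord z j * Q) * xcoord z j - ycoord z j * (- ycoord z j * P + xcoord z j * Q) by ring.
  by rewrite tan mulr0 subr0.
have -> : (xcoord z j ^+ 2 + ycoord z j ^+ 2) * Q =
  (xcoord z j * P + ycoord z j * Q) * ycoord z j + xcoord z j * (- ycoord z j * P + xcoord z j * Q) by ring.
by rewrite tan mulr0 addr0.
Qed.

Lemma base_diff_grad z s : V (mu_Cn z) -> free_point z ->
  f z *m scalemx s *m ('J f z)^T = z *m scalemx (s *m base_diff z).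
Proof.
move=> Vz zf; set J := 'J f z.
have coord i : (f z *m scalemx s *m J^T) 0 i = \sum_k s 0 k * dotk k (f z) (row i J).
  rewrite mxE sum_xy; apply: eq_bigr => k _.
  rewrite -/(xcoord (f z *m scalemx s) k) -/(ycoord (f z *m scalemx s) k) xcoord_scale ycoord_scale.
  by rewrite /dotk /xcoord /ycoord !mxE; ring.
apply: xy_ext => j; first rewrite xcoord_scale [LHS]coord; last rewrite ycoord_scale [LHS]coord.
all: rewrite mxE mulr_suml; apply: eq_bigr => k _.
all: by have [e1 e2] := base_diffP k j Vz zf; rewrite ?e1 ?e2 mulrA.
Qed.

(** The curve on the left is the image of a rotation orbit, along which the matrix
[base_diff] is constant; by [symplectic_gen] its velocity is [i s] times its
position, and [rot_ode] applies. *)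
Lemma base_diff_flow z s t : V (mu_Cn z) -> free_point z ->
  f (z *m rotmx (t *: (s *m base_diff z))) = f z *m rotmx (t *: s).
Proof.
move=> Vz zf; set a := s *m base_diff z.
have H t' : is_derive t' 1 (f \o (fun t => z *m rotmx (t *: a)))
    ((f \o (fun t => z *m rotmx (t *: a))) t' *m rotgen s).
  set w := z *m rotmx (t' *: a).
  have Vw : V (mu_Cn w) by rewrite mu_rot.
  have := is_derive_comp_jacobian (fibred_diff fV Vw) (is_derive_rot z a t').
  rewrite (@symplectic_gen _ _ _ s _ _ (f w)) //; first exact: (fibred_symp fV).
  by rewrite base_diff_grad ?base_diff_rot //; exact: free_point_rot.
by have := rot_ode H t; rewrite /= scale0r rotmx0.
Qed.

Lemma rot_fixed z s : free_point z -> z *m rotmx s = z ->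
  forall k, cos (s 0 k) = 1.
Proof.
move=> zf e k; have := zf k; rewrite mu_CnE => N0.
have ex := congr1 (fun z => xcoord z k) e; have ey := congr1 (fun z => ycoord z k) e.
rewrite /= xcoord_rot in ex; rewrite /= ycoord_rot in ey.
apply/(mulfI N0); set c := cos _ in ex ey *; set d := sin _ in ex ey *.
transitivity (xcoord z k * (c * xcoord z k - d * ycoord z k) + ycoord z k * (c * ycoord z k + d * xcoord z k)).
  by ring.
by rewrite ex ey; ring.
Qed.

(** Rotating the [k]-th coordinate of [f z] by a full turn brings [f z] back, so
by injectivity rotating [z] with the speeds in row [k] for the same time fixes
[z]. *)
Lemma base_diff_int z k j : V (mu_Cn z) -> free_point z -> exists m : int, base_diff z k j = m%:~R.
Proof.
move=> Vz zf.
have := base_diff_flow (delta_mx 0 k) (pi *+ 2) Vz zf; rewrite -rowE.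
set a := _ *: row _ _ => fa.
have za : z *m rotmx a = z.
  apply: (fibred_inj fV) => //; first by rewrite mu_rot.
  have period i : cos ((pi *+ 2 *: (delta_mx 0 k : 'rV[R]_n)) 0 i) = 1 /\
                  sin ((pi *+ 2 *: (delta_mx 0 k : 'rV[R]_n)) 0 i) = 0.
    rewrite !mxE eqxx /=; case: (i == k).
      by rewrite mulr1 cos2pi sin2pi.
    by rewrite mulr0 cos0 sin0.
  rewrite fa; apply: xy_ext => i; have [c1 s0] := period i.
    by rewrite xcoord_rot c1 s0 mul1r mul0r subr0.
  by rewrite ycoord_rot c1 s0 mul1r mul0r addr0.
apply: cos_eq1_int; rewrite -[RHS](rot_fixed zf za j).
by congr cos; rewrite mulrC [RHS]mxE [row _ _ _ _]mxE.
Qed.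

End Fibred.

(** * The matrix along segments of the base *)

Section LocalConstancy.
Context {R : realType}.

(** Otherwise the intermediate value theorem yields a half-integer value. *)
Lemma int_valued_segment (phi : R -> R) :
  (forall t, 0 <= t <= 1 -> {for t, continuous phi}) ->
  (forall t, 0 <= t <= 1 -> exists m : int, phi t = m%:~R) -> phi 0 = phi 1.
Proof.
move=> phic phiz; apply/eqP/negPn/negP => ne.
have [m0 e0] := phiz 0 (ltac:(by rewrite lexx ler01)).
have [m1 e1] := phiz 1 (ltac:(by rewrite lexx ler01)).
have c01 : {within `[(0 : R), 1], continuous phi}.
  apply: continuous_in_subspaceT => t; rewrite inE /= in_itv /=; exact: phic.
(* two distinct integers have a half-integer between them *)
pose v : R := Num.min (phi 0) (phi 1) + 2^-1.
have sep : Num.min (phi 0) (phi 1) <= v <= Num.max (phi 0) (phi 1).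
  rewrite /v e0 e1; rewrite e0 e1 eqr_int in ne.
  have : (m0 + 1 <= m1) || (m1 + 1 <= m0) by rewrite !lezD1; case: ltgtP ne.
  by rewrite -!(ler_int R) !intrD !mulr1z /Order.max /Order.min; case: ltP => ? /orP[] ?; apply/andP; split; lra.
have [t] := IVT ler01 c01 sep.
rewrite in_itv /= => /phiz[m ->].
rewrite /v e0 e1; have [q ->] : exists q : int, Num.min (m0%:~R) (m1%:~R) = q%:~R :> R.
  by rewrite /Order.min; case: ifP => _; [exists m0 | exists m1].
move=> /(congr1 (fun x => x - q%:~R)); rewrite addrAC subrr add0r -intrB.
set d := m - q => dh.
have : (0 < d)%R by rewrite -(ltr_int R) dh invr_gt0.
by rewrite -(lezD1 0) add0r -(ler_int R) dh mulr1z; lra.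
Qed.

End LocalConstancy.

Section Constancy.
Context {R : realType} {n : nat}.
Implicit Types (s a : 'rV[R]_n) (z v w : 'rV[R]_(n + n)) (k j : 'I_n) (t : R)
  (x y : 'rV[R]_n).
Variables (V : set 'rV[R]_n) (f : 'rV[R]_(n + n) -> 'rV[R]_(n + n)).
Hypothesis fV : fibred_symplectic V f.

Lemma continuous_base_diff z k j : V (mu_Cn z) -> free_point z ->
  {for z, continuous (fun w => base_diff f w k j)}.
Proof.
move=> Vz zf.
have fc p : {for z, continuous (fun w => f w 0 p)}.
  apply: (@continuous_comp _ _ _ f (fun w => w 0 p)).
    exact/differentiable_continuous/(fibred_diff fV).
  exact: coord_continuous.
have xcc p : {for z, continuous (fun w => w 0 p)} by exact: coord_continuous.
have Jc p q : {for z, continuous (fun w => 'J f w p q)} by exact: (fibred_C1 fV).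
have dc i : {for z, continuous (fun w => dotk k (f w) (row i ('J f w)))}.
  rewrite (_ : (fun w => _) =
    (fun w => f w 0 (lshift n k)) * (fun w => 'J f w i (lshift n k)) +
    (fun w => f w 0 (rshift n k)) * (fun w => 'J f w i (rshift n k))); last first.
    by apply/funext => w; rewrite /dotk /xcoord /ycoord ![row _ _ _ _]mxE.
  by apply: continuousD; apply: continuousM.
rewrite (_ : (fun w => _) =
  ((fun w : 'rV[R]_(n + n) => w 0 (lshift n j)) *
     (fun w => dotk k (f w) (row (lshift n j) ('J f w))) +
   (fun w : 'rV[R]_(n + n) => w 0 (rshift n j)) *
     (fun w => dotk k (f w) (row (rshift n j) ('J f w)))) *
  (fun w => (mu_Cn w 0 j)^-1)); last first.
  by apply/funext => w; rewrite mxE /radial mul_scale_delta dotkDr !dotkZr.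
apply: continuousM; first by apply: continuousD; apply: continuousM.
apply: continuousV; first exact: zf.
apply: (@continuous_comp _ _ _ (@mu_Cn R n : 'rV[R]_(n + n) -> 'rV[R]_n)
  (fun x : 'rV[R]_n => x 0 j)).
  exact: mu_continuous.
exact: coord_continuous.
Qed.

Definition positive x := forall k, 0 < x 0 k.
(** The section of [mu_Cn] with nonnegative real coordinates. *)
Definition real_point x : 'rV[R]_(n + n) := row_mx (\row_k Num.sqrt (x 0 k)) 0.

Lemma mu_real_point x : positive x -> mu_Cn (real_point x) = x.
Proof.
move=> xp; apply/rowP => k; rewrite mu_CnE /xcoord /ycoord row_mxEl row_mxEr !mxE.
by rewrite sqr_sqrtr ?ltW // expr0n addr0.
Qed.

Lemma polar z : free_point z -> exists s, z = real_point (mu_Cn z) *m rotmx s.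
Proof.
move=> zf; have /choice[s zs] : forall k, exists t,
    xcoord z k = cos t * Num.sqrt (mu_Cn z 0 k) /\ ycoord z k = sin t * Num.sqrt (mu_Cn z 0 k).
  move=> k; set r := Num.sqrt _.
  have r0 : r != 0 by rewrite sqrtr_eq0 -ltNge lt_neqAle eq_sym zf mu_Cn_ge0.
  have [|t [ct st]] := @circle_param R (xcoord z k / r) (ycoord z k / r).
    rewrite !expr_div_n -mulrDl -mu_CnE sqr_sqrtr ?mu_Cn_ge0 // divff //.
  by exists t; rewrite -ct -st !divfK.
exists (\row_k s k); apply: xy_ext => k; case: (zs k) => ex ey.
  by rewrite xcoord_rot ex {1}/xcoord /ycoord row_mxEl row_mxEr !mxE mulr0 subr0.
by rewrite ycoord_rot ey {1}/ycoord /xcoord row_mxEl row_mxEr !mxE mulr0 add0r.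
Qed.

Definition base_diff_at x := base_diff f (real_point x).

Lemma base_diff_real_point z : V (mu_Cn z) -> free_point z -> base_diff f z = base_diff_at (mu_Cn z).
Proof.
move=> Vz zf; have [s e] := polar zf.
rewrite {1}e (base_diff_rot fV) // mu_real_point //.
by move=> k; rewrite lt_neqAle eq_sym zf mu_Cn_ge0.
Qed.

Lemma free_point_real_point x : positive x -> free_point (real_point x).
Proof. by move=> xp k; rewrite mu_real_point // gt_eqF. Qed.

Lemma continuous_base x k j : V x -> positive x ->
  {for x, continuous (fun y => base_diff_at y k j)}.
Proof.
move=> Vx xp; apply: (@continuous_comp _ _ _ real_point (fun z => base_diff f z k j)).
  apply/differentiable_continuous; apply: differentiable_rV => p; rewrite -[p]fintype.splitK.
  case: (fintype.split p) => i /=.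
    rewrite (_ : (fun y => _) = Num.sqrt \o (fun y : 'rV[R]_n => y 0 i)); last first.
      by apply/funext => y; rewrite row_mxEl mxE.
    apply: differentiable_comp; first exact: differentiable_coord.
    apply/derivable1_diffP; have := is_derive1_sqrt (xp i).
    by move=> /(@ex_derive _ _ _ _ _ _ _).
  rewrite (_ : (fun y => _) = cst 0); first exact: differentiable_cst.
  by apply/funext => y; rewrite row_mxEr mxE.
by apply: continuous_base_diff; [rewrite mu_real_point | exact: free_point_real_point].
Qed.

(** The matrix is continuous with integer entries along the segment, which
consists of points with positive coordinates. *)
Lemma base_segment x y : (forall t, 0 <= t <= 1 -> V (x + t *: (y - x))) ->
  positive x -> positive y -> base_diff_at x = base_diff_at y.
Proof.
move=> Vxy xp yp; apply/matrixP => k j.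
have lp t : 0 <= t <= 1 -> positive (x + t *: (y - x)).
  move=> /andP[t0 t1] i; rewrite !mxE.
  have := xp i; have := yp i; move: (x 0 i) (y 0 i) => a b b0 a0.
  by have [->|/eqP t1'] := eqVneq t 1; nra.
have := @int_valued_segment R (fun t => base_diff_at (x + t *: (y - x)) k j).
rewrite scale0r addr0 scale1r subrKC; apply => t t01.
  apply: (@continuous_comp _ _ _ (fun t => x + t *: (y - x)) (fun y => base_diff_at y k j)).
    exact: is_derive1_continuous (is_derive_line x (y - x) t).
  exact: continuous_base (Vxy _ t01) (lp _ t01).
apply: (base_diff_int fV); first by rewrite mu_real_point; [exact: Vxy | exact: lp].
exact/free_point_real_point/lp.
Qed.

End Constancy.

(** * Equivariance over a connected base *)

Section Global.
Context {R : realType} {n : nat}.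
Implicit Types (s a : 'rV[R]_n) (z v w : 'rV[R]_(n + n)) (k j : 'I_n) (t : R)
  (x y : 'rV[R]_n).
Variables (V : set 'rV[R]_n) (f : 'rV[R]_(n + n) -> 'rV[R]_(n + n)).
Hypothesis fV : fibred_symplectic V f.

(** Adding a small constant to all the coordinates stays in [V] and leaves the
boundary of the orthant. *)
Lemma positive_dense x (N : set 'rV[R]_n) : V x -> nbhs x N ->
  exists y, [/\ N y, V y & positive y].
Proof.
have [W Wo VW] := fibred_open fV; rewrite VW => -[Wx xp] Nx.
have : nbhs x (N `&` W) by apply: filterI => //; exact: open_nbhs_nbhs.
move=> /nbhs_ballP[e /= e0 eNW].
have [] := eNW (x + const_mx (e / 2)).
  split=> // i k; rewrite /ball /= !mxE opprD addrA subrr add0r normrN gtr0_norm.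
    by rewrite gtr_pMr // invf_lt1 // ltr1n.
  by rewrite divr_gt0.
have pos : positive (x + const_mx (e / 2)).
  by move=> k; rewrite !mxE ltr_wpDl // divr_gt0.
by exists (x + const_mx (e / 2)); split=> //; split=> // k; exact/ltW/pos.
Qed.

(** Balls for the maximum norm are boxes, so their trace on the open orthant is
convex, also when the center is a corner. *)
Lemma base_locally_constant x : V x ->
  exists y, [/\ V y, positive y &
    nbhs x [set y' | V y' -> positive y' -> base_diff_at f y' = base_diff_at f y]].
Proof.
have [W Wo VW] := fibred_open fV => Vx.
have : nbhs x W by apply: open_nbhs_nbhs; split=> //; move: Vx; rewrite VW => -[].
move=> /nbhs_ballP[e /= e0 eW].
have [y [ey Vy yp]] := positive_dense Vx (nbhsx_ballx x _ e0).
exists y; split=> //; apply: filterS (nbhsx_ballx x _ e0) => y' ey' Vy' yp'.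
apply: (base_segment fV) => // t /andP[t0 t1].
have pt : orthant R n (y' + t *: (y - y')).
  move=> k; rewrite !mxE; have := yp' k; have := yp k; move: (y 0 k) (y' 0 k) => b c b0 c0.
  by have [->|/eqP t1'] := eqVneq t 1; nra.
rewrite VW; split=> //; apply: eW.
case: ey => _ ey; case: ey' => _ ey'; split=> // i k; have := ey i k; have := ey' i k.
rewrite /ball /= !mxE !ltr_norml.
move: (x i k) (y i k) (y' i k) => c b d /andP[h1 h2] /andP[h3 h4].
have [->|tn0] := eqVneq t 0; first by rewrite mul0r addr0 h1 h2.
have tp : 0 < t by rewrite lt_neqAle eq_sym tn0.
have p1 : 0 < t * (e - (c - b)) by rewrite mulr_gt0 // subr_gt0.
have p2 : 0 < t * (e + (c - b)) by rewrite mulr_gt0 // -ltrBlDl sub0r.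
have q1 : 0 <= (1 - t) * (e - (c - d)) by rewrite mulr_ge0 ?subr_ge0 // ltW.
have q2 : 0 <= (1 - t) * (e + (c - d)).
  by rewrite mulr_ge0 ?subr_ge0 // -lerBlDl sub0r ltW.
apply/andP; split; lra.
Qed.

(** Both the points of [V] near which the matrix has the value taken near [x0],
and those near which it does not, form relatively open sets.  They are disjoint
because positive points are dense, and cover [V] by local constancy. *)
Lemma base_constant : connected V -> V !=set0 ->
  exists M : 'M[R]_n, forall x, V x -> positive x -> base_diff_at f x = M.
Proof.
move=> Vc [x0 Vx0]; have [y0 [Vy0 yp0 near0]] := base_locally_constant Vx0.
exists (base_diff_at f y0).
pose C := [set y | V y -> positive y -> base_diff_at f y = base_diff_at f y0]°.
pose C' := [set y | V y -> positive y -> base_diff_at f y <> base_diff_at f y0]°.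
suff VC : V `&` C = V.
  by move=> x Vx xp; move: (Vx); rewrite -VC => -[_] /nbhs_singleton; apply.
apply: Vc; first by exists x0; split.
  by exists C => //; exact: open_interior.
exists (~` C'); first exact/open_closedC/open_interior.
apply/seteqP; split => x [Vx].
  move=> Cx; split=> // C'x.
  have [y [[h h'] Vy yp]] := positive_dense Vx (filterI Cx C'x).
  exact: (h' Vy yp (h Vy yp)).
move=> nC'x; split=> //.
have [y [Vy yp nx]] := base_locally_constant Vx.
have [e|ne] := pselect (base_diff_at f y = base_diff_at f y0).
  by apply: filterS nx => y' h Vy' yp'; rewrite h.
by case: nC'x; apply: filterS nx => y' h Vy' yp'; rewrite h.
Qed.

(** Adding [t] to the vanishing coordinates of [z] makes them nonzero for every
[t != 0]; let [t] tend to [0]. *)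
Lemma free_point_dense (F : 'rV[R]_(n + n) -> 'rV[R]_(n + n)) z :
  V (mu_Cn z) -> {for z, continuous F} ->
  (forall w, V (mu_Cn w) -> free_point w -> F w = 0) -> F z = 0.
Proof.
move=> Vz Fc F0.
pose e : 'rV[R]_(n + n) := row_mx (\row_k (mu_Cn z 0 k == 0)%:R) 0.
pose c t := z + t *: e.
have cc : {for 0, continuous c} := is_derive1_continuous (is_derive_line z e 0).
have c0 : c 0 = z by rewrite /c scale0r addr0.
have cfree t : t != 0 -> free_point (c t).
  move=> t0 k; rewrite mu_CnE /c !(xcoordD, ycoordD).
  have -> : xcoord (t *: e) k = t * (mu_Cn z 0 k == 0)%:R by rewrite /xcoord mxE row_mxEl mxE.
  have -> : ycoord (t *: e) k = 0 by rewrite /ycoord mxE row_mxEr mxE mulr0.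
  have [/eqP|] := eqVneq (mu_Cn z 0 k) 0; last first.
    by rewrite mulr0 !addr0 -mu_CnE.
  rewrite mu_CnE paddr_eq0 ?sqr_ge0 // !sqrf_eq0 => /andP[/eqP-> /eqP->].
  by rewrite mulr1 !add0r expr0n addr0 sqrf_eq0.
have Fcc : F (c t) @[t --> 0^'] --> F z.
  apply: cvg_within_filter.
  have H : {for 0, continuous (F \o c)} by apply: continuous_comp => //; rewrite c0.
  by rewrite -[X in F X]c0; exact: H.
have cV : \forall t \near 0^', V (mu_Cn (c t)).
  apply: cvg_within; apply: (cc [set w | V (mu_Cn w)]); rewrite c0.
  exact: mu_Cn_near (fibred_open fV) Vz.
apply: (cvg_unique _ Fcc) => //; apply: cvg_near_cst.
near=> t; apply: F0; first by near: t; exact: cV.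
by apply: cfree; near: t; exact: nbhs_dnbhs_neq.
Unshelve. all: by end_near. Qed.

(** At points with nonzero coordinates this is [base_diff_flow] at time [1], with
the constant value of the matrix; both sides are continuous and such points are
dense. *)
Theorem fibred_equivariant : connected V -> V !=set0 ->
  exists A : 'M[int]_n, forall s z, V (mu_Cn z) ->
    f (z *m rotmx (s *m map_mx intr A)) = f z *m rotmx s.
Proof.
move=> Vc V0; have [M MP] := base_constant Vc V0.
have [x0 Vx0] := V0.
have [y0 [_ Vy0 yp0]] := positive_dense Vx0 (@filterT _ (nbhs x0) _).
have /choice[A AP] : forall kj : 'I_n * 'I_n, exists m : int, M kj.1 kj.2 = m%:~R.
  move=> [k j] /=; rewrite -(MP y0) //; apply: (base_diff_int fV).
    by rewrite mu_real_point.
  exact: free_point_real_point.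
have MA : M = map_mx intr (\matrix_(k, j) A (k, j)).
  by apply/matrixP => k j; rewrite !mxE -AP.
exists (\matrix_(k, j) A (k, j)) => s z Vz; rewrite -MA; apply/subr0_eq.
apply: (free_point_dense (F := fun w => f (w *m rotmx (s *m M)) - f w *m rotmx s)) => //.
  apply: continuousB.
    apply: (@continuous_comp _ _ _ (mulmxr (rotmx (s *m M))) f).
      exact: mulmxr_continuous.
    apply/differentiable_continuous/(fibred_diff fV).
    by rewrite /= mu_rot.
  apply: (@continuous_comp _ _ _ f (mulmxr (rotmx s))).
    exact/differentiable_continuous/(fibred_diff fV).
  exact: mulmxr_continuous.
move=> w Vw wf; apply/eqP; rewrite subr_eq0; apply/eqP.
have := base_diff_flow fV s 1 Vw wf; rewrite !scale1r (base_diff_real_point fV) // MP //.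
by move=> k; rewrite lt_neqAle eq_sym wf mu_Cn_ge0.
Qed.

End Global.

(** * Automorphisms of the torus given by integer matrices *)

Section PolynomialMaps.
Context {R : realType} {m : nat}.
Local Notation U := 'rV[R]_m.

(** Polynomial functions as a class closed under partial derivatives: this makes
smoothness, a statement about all iterated derivatives, an easy induction. *)
Inductive real_poly : (U -> R) -> Prop :=
| RealPolyCst c : real_poly (fun=> c)
| RealPolyCoord i : real_poly (fun x => x 0 i)
| RealPolyAdd f g : real_poly f -> real_poly g -> real_poly (fun x => f x + g x)
| RealPolyMul f g : real_poly f -> real_poly g -> real_poly (fun x => f x * g x).

Lemma real_poly_differentiable f x : real_poly f -> differentiable f x.
Proof.
elim=> [c|i|g h _ gd _ hd|g h _ gd _ hd].
- exact: differentiable_cst.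
- exact: differentiable_coord.
- exact: differentiableD.
- exact: differentiableM.
Qed.

Lemma real_poly_derive f v : real_poly f -> real_poly ('D_v f).
Proof.
have der g x : real_poly g -> derivable g x v.
  by move=> gp; exact/diff_derivable/real_poly_differentiable.
elim=> [c|i|g h gp gd hp hd|g h gp gd hp hd].
- rewrite (_ : 'D_v _ = fun=> 0); first exact: RealPolyCst.
  by apply/funext => x; exact: derive_cst.
- rewrite (_ : 'D_v _ = fun=> v 0 i); first exact: RealPolyCst.
  apply/funext => x; have := is_derive_coord i (@is_derive_id _ _ x v).
  by case.
- rewrite (_ : 'D_v _ = fun x => 'D_v g x + 'D_v h x); first exact: RealPolyAdd.
  by apply/funext => x; apply: deriveD; exact: der.
rewrite (_ : 'D_v _ = fun x => g x * 'D_v h x + h x * 'D_v g x).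
  by apply: RealPolyAdd; exact: RealPolyMul.
by apply/funext => x; apply: deriveM; exact: der.
Qed.

Lemma smooth_real_poly p (F : U -> 'rV[R]_p) (D : set U) :
  (forall i, real_poly (fun x => F x 0 i)) -> smooth_open D F.
Proof.
move=> Fp vs x _; apply: differentiable_rV => i; apply: real_poly_differentiable.
elim: vs i => [|v vs IH] i //=.
rewrite (_ : (fun y => _) = 'D_v (fun y => iter_derive F vs y 0 i)).
  exact: real_poly_derive.
apply/funext => y; rewrite derive_mx ?mxE //; apply: diff_derivable.
by apply: differentiable_rV => j; exact: real_poly_differentiable.
Qed.

Definition complex_poly (h : U -> R[i]) : Prop :=
  real_poly (fun x => complex.Re (h x)) /\ real_poly (fun x => complex.Im (h x)).

Lemma complex_polyM g h :
  complex_poly g -> complex_poly h -> complex_poly (fun x => g x * h x).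
Proof.
move=> [gr gi] [hr hi]; split.
  rewrite (_ : (fun x => _) = fun x => complex.Re (g x) * complex.Re (h x) +
    (-1 * complex.Im (g x)) * complex.Im (h x)).
    by do ![apply: RealPolyAdd | apply: RealPolyMul | exact: RealPolyCst | by []].
  by apply/funext => x; case: (g x) (h x) => a b [c d] /=; rewrite mulN1r mulNr.
rewrite (_ : (fun x => _) = fun x => complex.Re (g x) * complex.Im (h x) +
    complex.Im (g x) * complex.Re (h x)).
  by do ![apply: RealPolyAdd | apply: RealPolyMul | exact: RealPolyCst | by []].
by apply/funext => x; case: (g x) (h x) => a b [c d].
Qed.

Lemma complex_poly1 : complex_poly (fun=> 1).
Proof. by split; exact: RealPolyCst. Qed.

Lemma complex_polyX h p : complex_poly h -> complex_poly (fun x => h x ^+ p).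
Proof.
move=> hp; elim: p => [|p IH]; first exact: complex_poly1.
rewrite (_ : (fun x => _) = fun x => h x * h x ^+ p).
  exact: complex_polyM.
by apply/funext => x; rewrite exprS.
Qed.

Lemma complex_poly_prod (I : Type) (r : seq I) (h : I -> U -> R[i]) :
  (forall i, complex_poly (h i)) -> complex_poly (fun x => \prod_(i <- r) h i x).
Proof.
move=> hp; elim: r => [|i r IH].
  rewrite (_ : (fun x => _) = fun=> 1); first exact: complex_poly1.
  by apply/funext => x; rewrite big_nil.
rewrite (_ : (fun x => _) = fun x => h i x * \prod_(i <- r) h i x).
  exact: complex_polyM.
by apply/funext => x; rewrite big_cons.
Qed.

End PolynomialMaps.

Section TorusAut.
Context {R : realType} {n : nat}.
Implicit Types (s : 'rV[R]_n) (A C : 'M[int]_n) (u v : @Cn R n).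

(** On the unit circle the inverse is the conjugate; writing negative powers this
way makes them polynomial, hence smooth on all of C. *)
Definition circle_pow (z : R[i]) (m : int) : R[i] :=
  match m with Posz p => z ^+ p | Negz p => (z^*)%C ^+ p.+1 end.

(** The homomorphism of the torus that is [s |-> s C] on the Lie algebra. *)
Definition torus_monomial C u : @Cn R n :=
  of_zcoord (fun j => \prod_k circle_pow (zcoord u k) (C k j)).

Definition cis (t : R) : R[i] := (cos t +i* sin t)%C.

Lemma cisD (a b : R) : cis (a + b) = cis a * cis b.
Proof. by rewrite /cis cosD sinD [sin a * cos b + _]addrC. Qed.

Lemma cis0 : cis 0 = 1. Proof. by rewrite /cis cos0 sin0. Qed.

Lemma cis_sum (I : Type) (r : seq I) (F : I -> R) :
  cis (\sum_(i <- r) F i) = \prod_(i <- r) cis (F i).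
Proof. by elim/big_rec2: _ => [|i a b _ <-]; rewrite ?cis0 ?cisD. Qed.

Lemma cisMn (a : R) p : cis (a *+ p) = cis a ^+ p.
Proof. by elim: p => [|p IH]; rewrite ?cis0 // mulrS cisD IH exprS. Qed.

Lemma cis_conj (a : R) : ((cis a)^*)%C = cis (- a).
Proof. by rewrite /cis cosN sinN. Qed.

Lemma cisMz (a : R) (m : int) : cis (a * m%:~R) = circle_pow (cis a) m.
Proof.
case: m => p; rewrite /circle_pow; first by rewrite -cisMn mulr_natr.
by rewrite cis_conj -cisMn NegzE mulrNz mulrN mulr_natr mulNrn.
Qed.

Lemma torus_monomial_expt C s :
  torus_monomial C (expt s) = expt (s *m map_mx intr C).
Proof.
apply: zcoord_inj => j; rewrite !zcoord_of -/(cis _) mxE cis_sum.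
by apply: eq_bigr => k _; rewrite mxE zcoord_of cisMz.
Qed.

Lemma smooth_torus_monomial C : smooth_map torus (torus_monomial C).
Proof.
have sm : smooth_open setT (torus_monomial C : 'rV[R]_(n + n) -> 'rV[R]_(n + n)).
  apply: smooth_real_poly => i.
  pose h j (z : 'rV[R]_(n + n)) := \prod_k circle_pow (zcoord z k) (C k j).
  have hp j : complex_poly (h j).
    apply: complex_poly_prod => k; rewrite /circle_pow; case: (C k j) => p; apply: complex_polyX.
      by split; exact: RealPolyCoord.
    split; first exact: RealPolyCoord.
    rewrite (_ : (fun x => _) = fun x : 'rV[R]_(n + n) => -1 * x 0 (rshift n k)).
      by apply: RealPolyMul; [exact: RealPolyCst | exact: RealPolyCoord].
    by apply/funext => x; rewrite mulN1r.
  rewrite -(fintype.splitK i); case: (fintype.split i) => j /=.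
    rewrite (_ : (fun x => _) = fun x => complex.Re (h j x)); first by case: (hp j).
    by apply/funext => x; rewrite row_mxEl mxE.
  rewrite (_ : (fun x => _) = fun x => complex.Im (h j x)); first by case: (hp j).
  by apply/funext => x; rewrite row_mxEr mxE.
split.
  apply: continuous_subspaceT => x.
  exact/differentiable_continuous/(sm [::]).
by move=> i j x _; exists setT, (torus_monomial C); split => //; exact: openT.
Qed.

Lemma torus_monomialK A C : C *m A = 1%:M ->
  forall u, torus u -> torus_monomial A (torus_monomial C u) = u.
Proof.
move=> CA u /torusE[s ->]; rewrite !torus_monomial_expt -mulmxA.
by rewrite -map_mxM CA map_mx1 mulmx1.
Qed.

Lemma torus_monomial_fun C : set_fun torus torus (torus_monomial C).
Proof. by move=> u /torusE[s ->]; rewrite torus_monomial_expt; apply/torusE; exists (s *m map_mx intr C). Qed.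

Lemma torus_aut_monomial A C : C *m A = 1%:M -> torus_aut (torus_monomial C).
Proof.
move=> CA; split.
  move=> u v /torusE[s ->] /torusE[r ->].
  by rewrite cmul_exptD !torus_monomial_expt cmul_exptD mulmxDl.
exists (torus_monomial A); split.
- exact: torus_monomial_fun.
- exact: torus_monomial_fun.
- by split; apply: torus_monomialK => //; exact: mulmx1C.
- exact: smooth_torus_monomial.
- exact: smooth_torus_monomial.
Qed.

Lemma equivariant_monomial C (D : set (@Cn R n)) (f : @Cn R n -> @Cn R n) :
  (forall s z, D z -> f (z *m rotmx s) = f z *m rotmx (s *m map_mx intr C)) ->
  equivariant (torus_monomial C) D f.
Proof.
move=> fC u z /torusE[s ->] Dz.
by rewrite torus_monomial_expt !cmul_expt fC.
Qed.

End TorusAut.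

(** * Regularity of the transition maps *)

Section C1.
Context {R : realType}.

Lemma near_eq_continuous {T S : topologicalType} (f g : T -> S) (z : T) :
  (\near z, f z = g z) -> {for z, continuous f} -> {for z, continuous g}.
Proof.
move=> fg; rewrite /prop_for /continuous_at (nbhs_singleton fg).
by apply: cvg_trans; apply: near_eq_cvg; apply: filterS fg.
Qed.

Definition C1_at m p (f : 'rV[R]_m -> 'rV[R]_p) z : Prop :=
  differentiable f z /\
  forall i j, {for z, continuous (fun w => 'J f w i j)}.

Lemma near_eq_C1 m p (f g : 'rV[R]_m -> 'rV[R]_p) z :
  (\near z, f z = g z) -> (\near z, differentiable f z) -> C1_at f z -> C1_at g z.
Proof.
move=> fg fdn [fd fc]; split; first exact: near_eq_differentiable fg fd.
move=> i j; have Jfg : \near z, 'J f z i j = 'J g z i j.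
  have := near_join fg; apply: filterS2 fdn => w wd wfg.
  by rewrite (near_eq_jacobian wfg wd).
exact: near_eq_continuous Jfg (fc i j).
Qed.

Lemma smooth_open_C1 m p (U : set 'rV[R]_m) (f : 'rV[R]_m -> 'rV[R]_p) z :
  open U -> U z -> smooth_open U f -> C1_at f z.
Proof.
move=> Uo Uz fs; split; first exact: (fs [::]).
move=> i j; have Dc : {for z, continuous (fun w => 'D_(delta_mx 0 i) f w 0 j)}.
  apply: (@continuous_comp _ _ _ ('D_(delta_mx 0 i) f) (fun v : 'rV[R]_p => v 0 j)).
    exact/differentiable_continuous/(fs [:: delta_mx 0 i]).
  exact: coord_continuous.
have DJ : \near z, 'D_(delta_mx 0 i) f z 0 j = 'J f z i j.
  apply: filterS (open_nbhs_nbhs (conj Uo Uz)) => w Uw.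
  by rewrite deriveEjacobian; [rewrite -rowE mxE | exact: (fs [::])].
exact: near_eq_continuous DJ Dc.
Qed.

Lemma C1_comp m p q (f : 'rV[R]_m -> 'rV[R]_p) (g : 'rV[R]_p -> 'rV[R]_q) z :
  (\near z, differentiable f z) -> (\near z, differentiable g (f z)) ->
  C1_at f z -> C1_at g (f z) -> C1_at (g \o f) z.
Proof.
move=> fdn gdn [fd fc] [gd gc]; split; first exact: differentiable_comp.
move=> i j; have JE : \near z, (\sum_r (fun w => 'J f w i r) * (fun w => 'J g (f w) r j)) z = 'J (g \o f) z i j.
  apply: filterS2 fdn gdn => w wd wd'.
  by rewrite jacobian_comp // mxE fct_sumE.
apply: (near_eq_continuous JE).
  elim/big_ind: _ => [|a b|r _]; [exact: cst_continuous | exact: continuousD |].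
  apply: continuousM; first exact: fc.
  apply: (@continuous_comp _ _ _ f (fun w => 'J g w r j)).
    exact: differentiable_continuous.
  exact: gc.
Qed.

End C1.

Section RelativelyOpen.

Lemma within_open_preimage (T S : topologicalType) (A : set T) (f : T -> S) O :
  {within A, continuous f} -> open O ->
  exists2 W, open W & A `&` f @^-1` O = A `&` W.
Proof.
move=> /continuousP fA /fA /open_subspaceP[W Wo WA].
by exists W => //; rewrite setIC -WA setIC.
Qed.

Lemma chart_image_open (R : realType) m (M : set 'rV[R]_m) (T : topologicalType)
    (c : chart M T) O : open O ->
  exists2 W, open W & c @` (O `&` chart_dom c) = W `&` M.
Proof.
move=> Oo; have [U Uo UM] := chart_cod_open c.
have [W Wo WO] := within_open_preimage (@chart_inv_cont _ _ _ _ c) Oo.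
exists (W `&` U); first exact: openI.
transitivity (c @` chart_dom c `&` chart_inv c @^-1` O); last first.
  by rewrite WO UM [RHS]setIC setIA [RHS]setIC -setIA [in RHS]setIC setIC.
apply/seteqP; split=> [_ [y [Oy cy] <-]|_ [[y cy <-]]].
  by split; [exists y | rewrite /= chart_mapK].
by rewrite /= chart_mapK // => Oy; exists y.
Qed.

End RelativelyOpen.

Section Transition.
Context {R : realType} {n : nat}.
Variables (X : manifold [set: 'rV[R]_(n + n)]) (omega : two_form X).
Variables (B : manifold (orthant R n)) (mu : X -> B).
Implicit Types (L : local_identification omega mu) (x : X) (y : B)
  (z w : 'rV[R]_(n + n)).

Lemma lid_invK L x : lid_dom L (mu x) -> lid_inv L (lid_map L x) = x.
Proof. by case: (lid_symplectomorphism L) => -[_ _ [K _] _ _] _; apply: K. Qed.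

Lemma lid_mapK L z y : lid_dom L y -> mu_Cn z = lid_chart L y ->
  mu (lid_inv L z) = y /\ lid_map L (lid_inv L z) = z.
Proof.
move=> Ly zy; have Ez : (mu_Cn @^-1` (lid_chart L @` chart_dom (lid_chart L))) z.
  by rewrite /= zy; exists y.
case: (lid_symplectomorphism L) => -[_ gE [_ K] _ _] _.
have := gE z Ez; rewrite /= => Lx; have e := lid_comm Lx; rewrite K // in e.
split; last exact: K.
by rewrite -(chart_mapK Lx) -e zy chart_mapK.
Qed.

Variables La Lb : local_identification omega mu.
Let Uab := lid_dom La `&` lid_dom Lb.
Let V := lid_chart Lb @` Uab.
Let f : 'rV[R]_(n + n) -> 'rV[R]_(n + n) := lid_map La \o lid_inv Lb.

Lemma base_image_open : exists2 W : set 'rV[R]_n, open W & V = W `&` orthant R n.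
Proof. exact: chart_image_open (chart_dom_open _). Qed.

Lemma lid_inv_dom z : V (mu_Cn z) ->
  [/\ lid_dom La (mu (lid_inv Lb z)), lid_dom Lb (mu (lid_inv Lb z)),
      lid_map Lb (lid_inv Lb z) = z &
      mu_Cn z = lid_chart Lb (mu (lid_inv Lb z))].
Proof. by case=> y [ay by_] /esym zy; have [-> ->] := lid_mapK by_ zy. Qed.

Lemma transition_mu z : V (mu_Cn z) ->
  mu_Cn (f z) = lid_chart La (chart_inv (lid_chart Lb) (mu_Cn z)).
Proof.
move=> /lid_inv_dom[az bz _ ->]; rewrite chart_mapK //.
exact: lid_comm.
Qed.

(** A local smooth extension [g] of [phi_b^-1], read in a chart of [X] around the
image of [z]. *)
Lemma lid_inv_local z : V (mu_Cn z) -> exists i g,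
  [/\ chart_dom (atlas i) (lid_inv Lb z), exists2 U, open U /\ U z & smooth_open U g &
      \forall w \near z, [/\ V (mu_Cn w), chart_dom (atlas i) (lid_inv Lb w) &
        g w = atlas i (lid_inv Lb w)]].
Proof.
move=> Vz; have [i _ ix] : (\bigcup_i chart_dom (atlas i)) (lid_inv Lb z).
  by rewrite (atlas_cover X).
case: (lid_symplectomorphism Lb) => -[_ _ _ _ [gc gs]] _.
have inE w : V (mu_Cn w) -> (mu_Cn @^-1` (lid_chart Lb @` chart_dom (lid_chart Lb))) w.
  by move=> /lid_inv_dom[_ bw _ e]; rewrite /= e; eexists; [exact: bw|].
have [|U [g [Uo Uz gsm gE]]] := gs tt i z.
  by exists z => //; split=> //; split=> //; exact: inE.
exists i, g; split=> //; first by exists U.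
have [W Wo WE] := within_open_preimage gc (chart_dom_open (atlas i)).
have Wz : nbhs z W.
  apply: open_nbhs_nbhs; split=> //.
  have : (mu_Cn @^-1` (lid_chart Lb @` chart_dom (lid_chart Lb)) `&` W) z.
    by rewrite -WE; split=> //; exact: inE.
  by case.
have Uz' : nbhs z U by apply: open_nbhs_nbhs.
near=> w; have Vw : V (mu_Cn w) by near: w; exact: mu_Cn_near base_image_open Vz.
have Ww : W w by near: w.
have Uw : U w by near: w.
have iw : chart_dom (atlas i) (lid_inv Lb w).
  have : (mu_Cn @^-1` (lid_chart Lb @` chart_dom (lid_chart Lb)) `&` W) w.
    by split=> //; exact: inE.
  by rewrite -WE => -[].
split=> //; rewrite -gE //.
by exists w => //; split=> //; split=> //; exact: inE.
Unshelve. all: by end_near. Qed.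

End Transition.

Section LidMap.
Context {R : realType} {n : nat}.
Variables (X : manifold [set: 'rV[R]_(n + n)]) (omega : two_form X).
Variables (B : manifold (orthant R n)) (mu : X -> B).
Hypothesis mu_cont : forall O : set B, open O -> open (mu @^-1` O).

(** A local smooth extension [g] of [phi], read in a chart of [X] at a point [x] of
its domain.  The second clause says that the chart covers a neighborhood of the
image of [x], so that [g] determines the differential of the map it extends. *)
Lemma lid_map_local (L : local_identification omega mu) i x :
  lid_dom L (mu x) -> chart_dom (atlas i) x -> exists g,
  [/\ exists2 U, open U /\ U (atlas i x) & smooth_open U g,
     \forall q \near atlas i x,
       exists x', [/\ lid_dom L (mu x'), chart_dom (atlas i) x' & q = atlas i x'] &
     \forall q \near atlas i x, g q = lid_map L (chart_inv (atlas i) q)].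
Proof.
move=> Lx ix.
case: (lid_symplectomorphism L) => -[_ _ _ [_ gs] _] _.
have [|U [g [Uo Ux gsm gE]]] := gs i tt (atlas i x); first by exists x.
have [W Wo WE] := chart_image_open (atlas i) (mu_cont (chart_dom_open (lid_chart L))).
have Wx : nbhs (atlas i x) W.
  apply: open_nbhs_nbhs; split=> //.
  have : (W `&` setT) (atlas i x) by rewrite -WE; exists x.
  by case.
have Wq q : W q -> exists x', [/\ lid_dom L (mu x'), chart_dom (atlas i) x' & q = atlas i x'].
  move=> Wq; have : (W `&` setT) q by [].
  by rewrite -WE => -[x' [? ?] <-]; exists x'.
exists g; split; [by exists U | exact: filterS Wx |].
apply: filterS2 Wx (open_nbhs_nbhs (conj Uo Ux)) => q /Wq[x' [Lx' ix' ->]] Uq.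
by rewrite -gE //; exists x'.
Qed.

End LidMap.

(** * Transition maps are symplectic over the base *)

Section TransitionFibred.
Context {R : realType} {n : nat}.
Variables (X : manifold [set: 'rV[R]_(n + n)]) (omega : two_form X).
Variables (B : manifold (orthant R n)) (mu : X -> B).
Hypothesis omega_symplectic : symplectic omega.
Hypothesis mu_cont : forall O : set B, open O -> open (mu @^-1` O).
Variables La Lb : local_identification omega mu.
Implicit Types (z w : 'rV[R]_(n + n)).
Local Notation V := (lid_chart Lb @` (lid_dom La `&` lid_dom Lb)).
Let f : 'rV[R]_(n + n) -> 'rV[R]_(n + n) := lid_map La \o lid_inv Lb.

(** Near [z] the transition map is the composite of the two local smooth
extensions: the chart of [X] between them cancels. *)
Lemma transition_C1 z : V (mu_Cn z) -> C1_at f z.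
Proof.
move=> Vz; have [az bz mz e] := lid_inv_dom Vz.
have [i [g [ix [U [Uo Uz] gs] gE]]] := lid_inv_local Vz.
have [h [[U' [Uo' Uz'] hs] _ hE]] := lid_map_local mu_cont az ix.
have [_ _ gz] := nbhs_singleton gE.
have dg : \forall w \near z, differentiable g w.
  by apply: filterS (open_nbhs_nbhs (conj Uo Uz)) => w; exact: (gs [::]).
have gc : {for z, continuous g}.
  exact: differentiable_continuous (nbhs_singleton dg).
have dh : \forall w \near z, differentiable h (g w).
  apply: (gc [set q | differentiable h q]); rewrite gz.
  by apply: filterS (open_nbhs_nbhs (conj Uo' Uz')) => w; exact: (hs [::]).
have hE' : \forall w \near z, h (g w) = lid_map La (chart_inv (atlas i) (g w)).
  by apply: (gc [set q | h q = lid_map La (chart_inv (atlas i) q)]); rewrite gz.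
apply: (@near_eq_C1 _ _ _ (h \o g)).
- near=> w; have [] : [/\ V (mu_Cn w), chart_dom (atlas i) (lid_inv Lb w) &
    g w = atlas i (lid_inv Lb w)] by near: w.
  move=> Vw iw gw; rewrite /= (near hE' w) // gw chart_mapK //.
- near=> w; apply: differentiable_comp; near: w; [exact: dg | exact: dh].
- apply: C1_comp => //; first exact: smooth_open_C1 Uo Uz gs.
  by rewrite gz; exact: smooth_open_C1 Uo' Uz' hs.
Unshelve. all: by end_near. Qed.

Lemma lid_pullback (L : local_identification omega mu) i x :
  lid_dom L (mu x) -> chart_dom (atlas i) x ->
  let F : 'rV[R]_(n + n) -> 'rV[R]_(n + n) := lid_map L \o chart_inv (atlas i) in
  differentiable F (atlas i x) /\
  omega i (atlas i x) =
    - pi^-1 *: ('J F (atlas i x) *m imx *m ('J F (atlas i x))^T).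
Proof.
move=> Lx ix F.
have [h [[U [Uo Ux] hs] _ hE]] := lid_map_local mu_cont Lx ix.
split.
  by apply: near_eq_differentiable hE _; exact: (hs [::]).
case: (lid_symplectomorphism L) => _ /(_ i tt (atlas i x)) /=.
rewrite omega_CnE -scalemxAr -scalemxAl; apply.
by exists x.
Qed.

(** Both identifications pull the standard form back to [omega], and the Jacobian
of [phi_a] is that of [phi_b] times that of [f].  Nondegeneracy of [omega] makes
the Jacobian of [phi_b] invertible, so it can be cancelled. *)
Lemma transition_symplectic z : V (mu_Cn z) ->
  'J f z *m imx *m ('J f z)^T = imx.
Proof.
move=> Vz; have [az bz mz e] := lid_inv_dom Vz.
have [i [_ [ix _ _]]] := lid_inv_local Vz.
set x := lid_inv Lb z in az bz mz ix; set p := atlas i x.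
have [da ea] := lid_pullback az ix; have [db eb] := lid_pullback bz ix.
have [_ [_ inA _]] := lid_map_local mu_cont az ix.
have [_ [_ inB _]] := lid_map_local mu_cont bz ix.
set Fa := lid_map La \o _ in da ea; set Fb := lid_map Lb \o _ in db eb.
have Fbp : Fb p = z by rewrite /Fb /= chart_mapK.
have fd : differentiable f (Fb p) by rewrite Fbp; case: (transition_C1 Vz).
have FbFa : \near p, (f \o Fb) p = Fa p.
  apply: filterS2 inA inB => q [x1 [ax1 ix1 ->]] [x2 [bx2 ix2 e12]].
  have e21 : x1 = x2 by rewrite -(chart_mapK ix1) e12 chart_mapK.
  by rewrite /f /Fb /Fa /= chart_mapK // e21 lid_invK.
have JJ : 'J Fa p = 'J Fb p *m 'J f z.
  rewrite -(near_eq_jacobian FbFa) -?Fbp ?jacobian_comp //.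
  exact: differentiable_comp.
have pi0 : - (pi : R)^-1 != 0 by rewrite oppr_eq0 invr_eq0 gt_eqF ?pi_gt0.
have := symplectic_nondegenerate omega_symplectic (i := i) (x := p) (ex_intro2 _ _ x ix erefl).
rewrite eb unitmxZ ?unitfE // !unitmx_mul unitmx_tr => /andP[/andP[Ju _] _].
move: ea; rewrite eb JJ => /(scalerI pi0) E.
exact: congruence_cancel Ju E.
Qed.

Lemma transition_fibred : fibred_symplectic V f.
Proof.
split.
- exact: base_image_open.
- by move=> z /transition_C1[].
- by move=> z i j /transition_C1[_]; apply.
- exact: transition_symplectic.
- move=> z w /lid_inv_dom[az _ mz _] /lid_inv_dom[aw _ mw _] e.
  rewrite -mz -mw; congr (lid_map Lb _).
  by rewrite -(lid_invK az) -(lid_invK aw); congr lid_inv.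
- move=> z w Vz e; rewrite !(@transition_mu _ _ _ _ _ _ La Lb) // -?e //.
Qed.

End TransitionFibred.

(** * The automorphism of an overlap *)

Section Inverse.
Context {R : realType} {n : nat}.
Implicit Types (s : 'rV[R]_n) (z w : 'rV[R]_(n + n)).

(** At a nonzero entry [m], the vector [s] with entry [pi / m] gives [cos pi]. *)
Lemma cos_eq1_mx0 (M : 'M[R]_n) : (forall s k, cos ((s *m M) 0 k) = 1) -> M = 0.
Proof.
move=> cM; apply/matrixP => k j; rewrite mxE; apply/eqP/negPn/negP => M0.
have := cM ((pi / M k j) *: delta_mx 0 k) j.
rewrite -scalemxAl mxE -rowE mxE divfK // cospi => /eqP.
by rewrite -subr_eq0 -opprD oppr_eq0 (_ : 1 + 1 = 2%:R) // pnatr_eq0.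
Qed.

(** At a point [w] of the image with nonzero coordinates, rotating by [s A C] and
by [s] gives the same result for every real vector [s]. *)
Lemma lattice_inverse (V V' : set 'rV[R]_n)
    (f g : 'rV[R]_(n + n) -> 'rV[R]_(n + n)) (A C : 'M[int]_n) :
  fibred_symplectic V' g -> V' !=set0 ->
  (forall w, V' (mu_Cn w) -> V (mu_Cn (g w)) /\ f (g w) = w) ->
  (forall s z, V (mu_Cn z) -> f (z *m rotmx (s *m map_mx intr A)) = f z *m rotmx s) ->
  (forall s z, V (mu_Cn z) -> f (z *m rotmx s) = f z *m rotmx (s *m map_mx intr C)) ->
  A *m C = 1%:M.
Proof.
move=> gV [x0 Vx0] gf fA fC.
have [x [_ Vx xp]] := positive_dense gV Vx0 filterT.
set w := real_point x; have wf : free_point w := free_point_real_point xp.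
have [Vz fz] : V (mu_Cn (g w)) /\ f (g w) = w by apply: gf; rewrite mu_real_point.
have M0 : map_mx intr (A *m C) - 1%:M = 0 :> 'M[R]_n.
  apply: cos_eq1_mx0 => s; apply: (rot_fixed wf).
  have := fA s _ Vz; rewrite fC // fz -mulmxA -map_mxM => e.
  by rewrite mulmxBr mulmx1 rotmxD e -rotmxD subrr rotmx0.
apply/matrixP => i j; apply/eqP; rewrite -(eqr_int R); apply/eqP.
have := congr1 (fun M : 'M[R]_n => M i j) (subr0_eq M0).
by rewrite !mxE; case: (i == j).
Qed.

End Inverse.

Theorem proposition3p13 (R : realType) (n : nat)
    (X : manifold [set: 'rV[R]_(n + n)]) (omega : two_form X)
    (X_closed : compact [set: X]) (omega_symplectic : symplectic omega)
    (B : manifold (orthant R n)) (mu : X -> B)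
    (mu_toric : locally_toric_fibration omega mu)
    (I : Type) (L : I -> local_identification omega mu)
    (L_system : local_identification_system L)
    (overlap_connected : forall a b : I, a <> b ->
       connected (lid_dom (L a) `&` lid_dom (L b))) :
  forall a b : I,
    let Uab := lid_dom (L a) `&` lid_dom (L b) in
    let Da := mu_Cn @^-1` (lid_chart (L a) @` Uab) in
    let Db := mu_Cn @^-1` (lid_chart (L b) @` Uab) in
    let f := lid_map (L a) \o lid_inv (L b) in
    Uab !=set0 ->
    exists rho : @Cn R n -> @Cn R n,
      [/\ torus_aut rho, set_fun Db Da f & equivariant rho Db f].
Proof.
move=> a b Uab Da Db f U0.
have mu_cont (O : set B) : open O -> open (mu @^-1` O).
  move=> Oo; case: mu_toric => -[muc _] _.
  by have [W Wo] := within_open_preimage muc Oo; rewrite !setTI => ->.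
have fD : set_fun Db Da f.
  move=> z Dz; have [az bz _ _] := lid_inv_dom Dz.
  by exists (mu (lid_inv (L b) z)) => //; rewrite -(lid_comm az).
have [ab|ab] := pselect (a = b).
  (* f is the identity here, and the overlap, a single chart domain, may be
     disconnected *)
  exists (torus_monomial 1%:M); split=> //.
    by apply: (torus_aut_monomial (A := 1%:M)); rewrite mulmx1.
  apply: equivariant_monomial => s z Dz; rewrite map_mx1 mulmx1.
  have fK w : Db w -> f w = w by move=> Dw; have [_ _ + _] := lid_inv_dom Dw; rewrite /f ab.
  by rewrite !fK //; rewrite /Db /= mu_rot.
have img_connected c d : c <> d ->
    connected (lid_chart (L d) @` (lid_dom (L c) `&` lid_dom (L d))).
  move=> cd; apply: connected_continuous_connected; first exact: overlap_connected.
  by apply: continuous_subspaceW (@chart_map_cont _ _ _ _ (lid_chart (L d))) => y [].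
have img0 c d : lid_dom (L c) `&` lid_dom (L d) !=set0 ->
    lid_chart (L d) @` (lid_dom (L c) `&` lid_dom (L d)) !=set0.
  by case=> y Uy; exists (lid_chart (L d) y); exists y.
have U0' : lid_dom (L b) `&` lid_dom (L a) !=set0 by rewrite setIC.
have fF := transition_fibred omega_symplectic mu_cont (L a) (L b).
have gF := transition_fibred omega_symplectic mu_cont (L b) (L a).
have [A fA] := fibred_equivariant fF (img_connected _ _ ab) (img0 _ _ U0).
have [C gC] := fibred_equivariant gF (img_connected _ _ (nesym ab)) (img0 _ _ U0').
set g := lid_map (L b) \o lid_inv (L a) in gF gC.
have gD w : Da w -> Db (g w) /\ f (g w) = w.
  rewrite /Da /Uab setIC => Dw; have [bw aw mw ew] := lid_inv_dom Dw.
  rewrite /f /g /= lid_invK //; split=> //.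
  by rewrite /Db /= (lid_comm bw); eexists; [split; [exact: aw | exact: bw]|].
have gfK z : Db z -> g (f z) = z.
  by move=> Dz; have [az bz mz ez] := lid_inv_dom Dz; rewrite /f /g /= lid_invK.
have fC s z : Db z -> f (z *m rotmx s) = f z *m rotmx (s *m map_mx intr C).
  move=> Dz; have Dfz : Da (f z *m rotmx (s *m map_mx intr C)).
    by rewrite /Da /= mu_rot; exact: fD.
  have <- := (gD _ Dfz).2; congr f; rewrite gC ?gfK //.
  by rewrite setIC; exact: fD.
exists (torus_monomial C); split=> //; last exact: equivariant_monomial.
apply: (torus_aut_monomial (A := A)); apply: mulmx1C.
apply: (lattice_inverse gF (img0 _ _ U0') _ fA fC) => w.
by rewrite setIC; exact: gD.
Qed.
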